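(* Let $\bar H:\bar{\mathcal G}\to\bar{\mathcal G}$ be a graph-of-groups isomorphism which acts as the identity on the underlying graph $\bar\Gamma$ of $\bar{\mathcal G}$. Let $V_1,\dots,V_m$ be distinct vertices of $\bar\Gamma$, and assume that for each $i$ the vertex group isomorphism $\bar H_{V_i}$ is induced by a local graph-of-groups automorphism $H_i:\mathcal G_i\to\mathcal G_i$ which acts as the identity on its underlying graph $\Gamma(\mathcal G_i)$; that is, there are a vertex $p_i\in V(\mathcal G_i)$ and a group isomorphism $\theta_i:G_{V_i}\to\pi_1(\mathcal G_i,p_i)$ with $\theta_i\circ\bar H_{V_i}=(H_i)_{*p_i}\circ\theta_i$. Then $(\bar H,\bar{\mathcal G})$ can be blown up via the family $(H_i,\mathcal G_i)_{i=1,\dots,m}$ to a blow-up graph-of-groups isomorphism $H:\mathcal G\to\mathcal G$, whose induced outer automorphism $\hat H$ agrees with $\hat{\bar H}$ (via the canonical isomorphism $\Theta:\pi_1(\bar{\mathcal G})\to\pi_1(\mathcal G)$, i.e. $\hat\Theta\,\hat{\bar H}=\hat H\,\hat\Theta$), if and only if each $(H_i,\mathcal G_i)$ is compatible with $(\bar H,\bar{\mathcal G})$.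
   Context: Graphs are finite, non-empty, connected graphs in the sense of Serre: each edge $e$ is oriented with reverse $\bar e$ and terminal vertex $\tau(e)$, and $\iota(e)=\tau(\bar e)$. For $x$ in a group, $ad_x(g)=xgx^{-1}$. A graph-of-groups $\mathcal G$ consists of a graph $\Gamma=\Gamma(\mathcal G)$ (with vertex set $V(\mathcal G)$ and edge set $E(\mathcal G)$), vertex groups $G_v$, edge groups $G_e=G_{\bar e}$, and injective edge homomorphisms $f_e:G_e\to G_{\tau(e)}$. The path group $\Pi(\mathcal G)$ is the quotient of the free product of all $G_v$ and the free group on $\{t_e : e\in E(\Gamma)\}$ by the relations $t_{\bar e}=t_e^{-1}$ and $f_{\bar e}(g)=t_ef_e(g)t_e^{-1}$ ($g\in G_e$). A word $r_0t_{e_1}r_1\cdots t_{e_q}r_q$ ($q\ge 0$) is connected from $v$ to $w$ if $e_1\cdots e_q$ is an edge path from $v$ to $w$ and $r_0\in G_v$, $r_i\in G_{\tau(e_i)}$ (for $q=0$: $v=w$, $r_0\in G_v$). $\pi_1(\mathcal G,v)\subset\Pi(\mathcal G)$ is the subgroup of elements represented by connected words from $v$ to $v$. A sub-graph-of-groups is the restriction of $\mathcal G$ to a connected subgraph. A graph-of-groups isomorphism $H:\mathcal G_1\to\mathcal G_2$ consists of a graph isomorphism $H_\Gamma$, group isomorphisms $H_v:G_v\to G_{H_\Gamma(v)}$ and $H_e=H_{\bar e}:G_e\to G_{H_\Gamma(e)}$, and correction terms $\delta(e)\in G_{\tau(H_\Gamma(e))}$ with $H_{\tau(e)}f_e=ad_{\delta(e)}f_{H_\Gamma(e)}H_e$.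 It induces an isomorphism $H_*:\Pi(\mathcal G_1)\to\Pi(\mathcal G_2)$ by $H_*(g)=H_v(g)$ for $g\in G_v$ and $H_*(t_e)=\delta(\bar e)t_{H_\Gamma(e)}\delta(e)^{-1}$, which restricts to isomorphisms $H_{*v}:\pi_1(\mathcal G_1,v)\to\pi_1(\mathcal G_2,H_\Gamma(v))$; the resulting outer isomorphism $\hat H:\pi_1(\mathcal G_1)\to\pi_1(\mathcal G_2)$ does not depend on the base point. Compatibility. $(H_i,\mathcal G_i)$ is compatible with $(\bar H,\bar{\mathcal G})$ if for every edge $E$ of $\bar\Gamma$ with $\tau(E)=V_i$ there exist a vertex $v(E)\in V(\mathcal G_i)$ and an element $\gamma_E\in\Pi(\mathcal G_i)$ represented by a connected word from $p_i$ to $v(E)$ such that both (A2) $\theta_i(f_E(G_E))\subset\gamma_EG_{v(E)}\gamma_E^{-1}$, and (A3) $(H_i)_*(\gamma_E^{-1})\,\theta_i(\delta(E))\,\gamma_E\in G_{v(E)}$. Blow-up. A blow-up of $(\bar H,\bar{\mathcal G})$ via $(H_i,\mathcal G_i)_i$ is a graph-of-groups $\mathcal G$ with an isomorphism $H:\mathcal G\to\mathcal G$ acting as the identity on $\Gamma(\mathcal G)$, such that the $\mathcal G_i$ are pairwise disjoint sub-graphs-of-groups of $\mathcal G$, $H$ restricts to $H_i$ on each $\mathcal G_i$, and the quotient of $(H,\mathcal G)$ modulo the $(H_i,\mathcal G_i)$ is $(\bar H,\bar{\mathcal G})$. The latter means the following. The graph $\bar\Gamma$ is obtained from $\Gamma(\mathcal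 G)$ by contracting each $\Gamma(\mathcal G_i)$ to the single vertex $V_i$; the remaining vertices $v$ and edges $e$ of $\mathcal G$ are in natural bijection with the vertices $V\notin\{V_1,\dots,V_m\}$ and the edges $E$ of $\bar\Gamma$. For corresponding objects, $G_V=G_v$, $G_E=G_e$, $\bar H_V=H_v$, $\bar H_E=H_e$. If $\tau(E)\notin\{V_1,\dots,V_m\}$, then $f_E=f_e$ and $\delta(E)=\delta(e)$. If $\tau(E)=V_i$, then $\tau(e)\in V(\mathcal G_i)$ and there is an element $\gamma_E\in\Pi(\mathcal G_i)$ represented by a connected word from $p_i$ to $\tau(e)$ with $\theta_i\circ f_E=ad_{\gamma_E}\circ f_e$ and $\theta_i(\delta(E))=H_*(\gamma_E)\,\delta(e)\,\gamma_E^{-1}$. (On $V_i$ one has $\theta_i\circ\bar H_{V_i}=(H_i)_{*p_i}\circ\theta_i$.) The canonical isomorphism $\Theta$ is the restriction to $\pi_1(\bar{\mathcal G},V_i)\to\pi_1(\mathcal G,p_i)$ of the homomorphism $\Pi(\bar{\mathcal G})\to\Pi(\mathcal G)$ which is $\theta_i$ on $G_{V_i}$, the identity on the other vertex groups, and sends $t_E\mapsto\gamma_{\bar E}t_e\gamma_E^{-1}$, where $\gamma_E:=1$ if $\tau(E)\notin\{V_1,\dots,V_m\}$ (likewise for $\gamma_{\bar E}$). $\hat\Theta$ denotes its class modulo inner automorphisms. *)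

(* Defs.v *)
From HB Require Import structures.
From mathcomp Require Import all_boot generic_quotient boolp.

Set Implicit Arguments.
Unset Strict Implicit.
Unset Printing Implicit Defensive.

Local Open Scope quotient_scope.
Local Open Scope group_scope.

Definition ad (G : groupType) (x g : G) : G := x * g * x^-1.

Record grp_iso (G H : groupType) := GrpIso {
  iso_fun :> {multiplicative G -> H};
  iso_bij : bijective iso_fun }.

(* phi and psi define the same class modulo inner automorphisms of B. *)
Definition outer_eq (A B : groupType) (phi psi : A -> B) : Prop :=
  exists c : B, forall x : A, phi x = ad c (psi x).

Section Morphisms.
Variables (G H : groupType) (f : {multiplicative G -> H}).

Lemma hom1 : f 1 = 1.
Proof. by apply: (mulgI (f 1)); rewrite -gmulfM !mulg1. Qed.

Lemma homV : {morph f : x / x^-1}.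
Proof. by move=> x; apply: (mulgI (f x)); rewrite -gmulfM !mulgV hom1. Qed.
End Morphisms.

(* A Serre graph is given by its geometric edges: the oriented edges are the
   pairs (u, b), and reversal flips b, hence is a fixed-point-free involution.
   In this way G_e = G_(ebar e) below holds by definition, the edge groups being
   indexed by geometric edges. *)
Record graph := Graph {
  vertex : finType;
  gedge : finType;
  term : gedge * bool -> vertex;
  graph_nonempty : 0 < #|vertex|;
  graph_connected : forall v w : vertex,
    connect (fun x y => [exists e : gedge * bool,
                           (term (e.1, ~~ e.2) == x) && (term e == y)]) v w }.

Definition edge (A : graph) : finType := (gedge A * bool)%type.
Definition ebar (A : graph) (e : edge A) : edge A := (e.1, ~~ e.2).
Definition tau (A : graph) (e : edge A) : vertex A := term e.
Definition iota (A : graph) (e : edge A) : vertex A := tau (ebar e).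

Lemma ebarK (A : graph) : involutive (@ebar A).
Proof. by case=> u b; rewrite /ebar /= negbK. Qed.

(* These are exactly the maps between oriented edges that commute with ebar. *)
Record edge_map (A B : graph) := EdgeMap {
  em_gedge : gedge A -> gedge B;
  em_flip : gedge A -> bool }.

Definition edge_map_fun (A B : graph) (j : edge_map A B) (e : edge A) : edge B :=
  (em_gedge j e.1, em_flip j e.1 (+) e.2).
Coercion edge_map_fun : edge_map >-> Funclass.

Lemma edge_map_ebar (A B : graph) (j : edge_map A B) (e : edge A) :
  j (ebar e) = ebar (j e).
Proof. by rewrite /ebar /edge_map_fun /= addbN. Qed.

Record gog := Gog {
  gog_graph :> graph;
  Gv : vertex gog_graph -> groupType;
  Ge : gedge gog_graph -> groupType;
  fe : forall e : edge gog_graph, {multiplicative Ge e.1 -> Gv (tau e)};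
  fe_inj : forall e : edge gog_graph, injective (fe e) }.

Arguments Gv : clear implicits.
Arguments Ge : clear implicits.
Arguments fe {g} e : rename.

Definition castv (G : gog) (v w : vertex G) (h : v = w) : Gv G v -> Gv G w :=
  eq_rect v (fun x => Gv G v -> Gv G x) id w h.

(* Graph-of-groups isomorphisms G -> G acting as the identity on the graph. *)
Record gog_aut (G : gog) := GogAut {
  Hv : forall v : vertex G, grp_iso (Gv G v) (Gv G v);
  He : forall u : gedge G, grp_iso (Ge G u) (Ge G u);
  delta : forall e : edge G, Gv G (tau e);
  aut_comm : forall (e : edge G) (g : Ge G e.1),
    Hv (tau e) (fe e g) = ad (delta e) (fe e (He e.1 g)) }.

Arguments Hv {G} H v : rename.
Arguments He {G} H u : rename.
Arguments delta {G} H e : rename.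
Arguments aut_comm {G} H e g : rename.

Section PathGroup.
Variable G : gog.

Definition letter : choiceType := ({v : vertex G & Gv G v} + edge G)%type.
Definition word : choiceType := seq letter.
Definition lV (v : vertex G) (x : Gv G v) : letter := inl (existT (Gv G) v x).
Definition lE (e : edge G) : letter := inr e.

(* The congruence presenting the path group as a monoid; formal inverses of the
   t_e are not needed as generators, since t_e t_(ebar e) = 1. *)
Inductive word_eq : word -> word -> Prop :=
| we_refl s : word_eq s s
| we_sym s1 s2 : word_eq s1 s2 -> word_eq s2 s1
| we_trans s1 s2 s3 : word_eq s1 s2 -> word_eq s2 s3 -> word_eq s1 s3
| we_cat s1 s2 r1 r2 :
    word_eq s1 s2 -> word_eq r1 r2 -> word_eq (s1 ++ r1) (s2 ++ r2)
| we_one v : word_eq [:: lV (1 : Gv G v)] [::]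
| we_mul v (x y : Gv G v) : word_eq [:: lV x; lV y] [:: lV (x * y)]
| we_ebar e : word_eq [:: lE e; lE (ebar e)] [::]
| we_edge (e : edge G) (g : Ge G e.1) :
    word_eq [:: lV (fe (ebar e) g)] [:: lE e; lV (fe e g); lE (ebar e)].

Definition word_eqb : rel word := fun s1 s2 => `[< word_eq s1 s2 >].

Lemma word_eqb_refl : reflexive word_eqb.
Proof. by move=> s; apply/asboolP; apply: we_refl. Qed.

Lemma word_eqb_sym : symmetric word_eqb.
Proof. by move=> s1 s2; apply/asboolP/asboolP; apply: we_sym. Qed.

Lemma word_eqb_trans : transitive word_eqb.
Proof.
by move=> s2 s1 s3 /asboolP h1 /asboolP h2; apply/asboolP; apply: we_trans h2.
Qed.

Canonical word_equiv :=
  EquivRel word_eqb word_eqb_refl word_eqb_sym word_eqb_trans.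

Definition Pi := {eq_quot word_equiv}.
HB.instance Definition _ := Choice.on Pi.
HB.instance Definition _ := EqQuotient.on Pi.

Definition word_class (s : word) : Pi := \pi s.

Lemma word_classE s1 s2 : word_class s1 = word_class s2 <-> word_eq s1 s2.
Proof.
split=> [/eqquotP/asboolP //|h]; by apply/eqquotP/asboolP.
Qed.

Lemma word_class_repr (x : Pi) : word_class (repr x) = x.
Proof. exact: reprK. Qed.

Lemma repr_word_class s : word_eq (repr (word_class s)) s.
Proof. by apply/word_classE; apply: word_class_repr. Qed.

Definition inv_letter (l : letter) : letter :=
  match l with
  | inl vx => lV (projT2 vx)^-1
  | inr e => lE (ebar e)
  end.

Definition inv_word (s : word) : word := rev (map inv_letter s).

Definition Pi_one : Pi := word_class [::].
Definition Pi_mul (x y : Pi) : Pi := word_class (repr x ++ repr y).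
Definition Pi_inv (x : Pi) : Pi := word_class (inv_word (repr x)).

Lemma Pi_mulE s1 s2 :
  Pi_mul (word_class s1) (word_class s2) = word_class (s1 ++ s2).
Proof. by apply/word_classE/we_cat; apply: repr_word_class. Qed.

Lemma inv_letterK : involutive inv_letter.
Proof.
by case=> [[v x]|e] /=; rewrite /lV /lE /= ?invgK ?ebarK.
Qed.

Lemma inv_wordK : involutive inv_word.
Proof. by move=> s; rewrite /inv_word map_rev revK mapK //; apply: inv_letterK. Qed.

Lemma inv_letterP l : word_eq [:: l; inv_letter l] [::].
Proof.
case: l => [[v x]|e] /=; last exact: we_ebar.
by apply: we_trans (we_mul _ _) _; rewrite mulgV; apply: we_one.
Qed.

Lemma inv_wordP s : word_eq (s ++ inv_word s) [::].
Proof.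
elim: s => [|l s IH]; first exact: we_refl.
rewrite /inv_word /= rev_cons -cats1 catA -cat1s -!catA.
apply: we_trans (inv_letterP l).
rewrite -[[:: l; _]]cat1s; apply: we_cat; first exact: we_refl.
rewrite catA -[X in word_eq _ X]cat0s; apply: we_cat IH _; exact: we_refl.
Qed.

Lemma Pi_mulA : associative Pi_mul.
Proof.
move=> x y z; rewrite -[x]word_class_repr -[y]word_class_repr.
by rewrite -[z]word_class_repr !Pi_mulE catA.
Qed.

Lemma Pi_mul1 : left_id Pi_one Pi_mul.
Proof. by move=> x; rewrite -[x]word_class_repr Pi_mulE. Qed.

Lemma Pi_mulr1 : right_id Pi_one Pi_mul.
Proof. by move=> x; rewrite -[x]word_class_repr Pi_mulE cats0. Qed.

Lemma Pi_mulrV : right_inverse Pi_one Pi_inv Pi_mul.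
Proof.
move=> x; rewrite -{1}[x]word_class_repr Pi_mulE.
by apply/word_classE/inv_wordP.
Qed.

Lemma Pi_mulV : left_inverse Pi_one Pi_inv Pi_mul.
Proof.
move=> x; rewrite -{2}[x]word_class_repr Pi_mulE.
by apply/word_classE; rewrite -{2}[repr x]inv_wordK; apply: inv_wordP.
Qed.

HB.instance Definition _ := isGroup.Build Pi
  Pi_mulA Pi_mul1 Pi_mulr1 Pi_mulV Pi_mulrV.

Definition vel (v : vertex G) (x : Gv G v) : Pi := word_class [:: lV x].
Definition tel (e : edge G) : Pi := word_class [:: lE e].

Lemma word_class_cat s1 s2 :
  word_class (s1 ++ s2) = word_class s1 * word_class s2.
Proof. by rewrite -Pi_mulE. Qed.

Lemma word_class_nil : word_class [::] = 1.
Proof. by []. Qed.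

Lemma velM v : {morph @vel v : x y / x * y}.
Proof.
move=> x y; rewrite /vel -word_class_cat; apply/word_classE.
exact/we_sym/we_mul.
Qed.

HB.instance Definition _ v := isMultiplicative.Build _ _ (@vel v) (@velM v).

Lemma vel1 v : vel (1 : Gv G v) = 1.
Proof. exact: hom1. Qed.

Lemma velV v : {morph @vel v : x / x^-1}.
Proof. exact: homV. Qed.

Lemma tel_ebar e : tel (ebar e) = (tel e)^-1.
Proof.
apply: (mulgI (tel e)); rewrite mulgV /tel -word_class_cat.
exact/word_classE/we_ebar.
Qed.

Lemma vel_ebar (e : edge G) (g : Ge G e.1) :
  vel (fe (ebar e) g) = ad (tel e) (vel (fe e g)).
Proof.
rewrite /ad -tel_ebar /vel /tel.
rewrite -(word_class_cat [:: lE e] [:: lV (fe e g)]) -word_class_cat.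
exact/word_classE/we_edge.
Qed.

Section Lift.
Variables (P : groupType) (phiV : forall v : vertex G, Gv G v -> P)
          (phiE : edge G -> P).

Definition lift_letter (l : letter) : P :=
  match l with
  | inl vx => phiV (projT2 vx)
  | inr e => phiE e
  end.

Definition lift_word (s : word) : P := \prod_(l <- s) lift_letter l.

(* Independent of the representative, and the homomorphism extending phiV and
   phiE, as soon as these are compatible with the relations of Pi: see
   Pi_lift_vel, Pi_lift_tel and Pi_liftM. *)
Definition Pi_lift (x : Pi) : P := lift_word (repr x).

Hypothesis phiVM : forall v, {morph @phiV v : x y / x * y}.
Hypothesis phiE_ebar : forall e, phiE (ebar e) = (phiE e)^-1.
Hypothesis phi_edge : forall (e : edge G) (g : Ge G e.1),
  phiV (fe (ebar e) g) = ad (phiE e) (phiV (fe e g)).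

Lemma lift_word_eq s1 s2 : word_eq s1 s2 -> lift_word s1 = lift_word s2.
Proof.
rewrite /lift_word; elim=> {s1 s2} //.
- by move=> s1 s2 s3 _ -> _ ->.
- by move=> s1 s2 r1 r2 _ h1 _ h2; rewrite !big_cat /= h1 h2.
- move=> v; rewrite big_seq1 big_nil /=.
  by apply: (mulgI (phiV (1 : Gv G v))); rewrite -phiVM !mulg1.
- by move=> v x y; rewrite !big_cons !big_nil /= !mulg1 phiVM.
- by move=> e; rewrite !big_cons !big_nil /= mulg1 phiE_ebar mulgV.
- move=> e g; rewrite !big_cons !big_nil /= !mulg1 phi_edge /ad.
  by rewrite phiE_ebar mulgA.
Qed.

Lemma Pi_lift_class s : Pi_lift (word_class s) = lift_word s.
Proof. exact/lift_word_eq/repr_word_class. Qed.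

Lemma Pi_liftM : {morph Pi_lift : x y / x * y}.
Proof.
move=> x y; rewrite -[x]word_class_repr -[y]word_class_repr.
by rewrite -word_class_cat !Pi_lift_class /lift_word big_cat.
Qed.

Lemma Pi_lift_vel v (x : Gv G v) : Pi_lift (vel x) = phiV x.
Proof. by rewrite Pi_lift_class /lift_word big_seq1. Qed.

Lemma Pi_lift_tel e : Pi_lift (tel e) = phiE e.
Proof. by rewrite Pi_lift_class /lift_word big_seq1. Qed.
End Lift.

Inductive connected_word (v : vertex G) : vertex G -> word -> Prop :=
| cw_vertex (r : Gv G v) : connected_word v v [:: lV r]
| cw_edge (s : word) (e : edge G) (r : Gv G (tau e)) :
    connected_word v (iota e) s ->
    connected_word v (tau e) (s ++ [:: lE e; lV r]).

Definition connected_elt (v w : vertex G) (x : Pi) : Prop :=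
  exists2 s : word, connected_word v w s & x = word_class s.

Lemma connected_elt_ind (v : vertex G) (Q : vertex G -> Pi -> Prop) :
  (forall r : Gv G v, Q v (vel r)) ->
  (forall x (e : edge G) (r : Gv G (tau e)), connected_elt v (iota e) x ->
     Q (iota e) x -> Q (tau e) (x * tel e * vel r)) ->
  forall w x, connected_elt v w x -> Q w x.
Proof.
move=> h0 hS w x [s hs ->]; elim: hs => {w s} [r|s e r hs IH]; first exact: h0.
rewrite word_class_cat -[[:: _; _]]cat1s word_class_cat mulgA.
by apply: hS IH; exists s.
Qed.

Lemma connected_vel v (r : Gv G v) : connected_elt v v (vel r).
Proof. by exists [:: lV r] => //; apply: cw_vertex. Qed.

Lemma connected_step v (e : edge G) x (r : Gv G (tau e)) :
  connected_elt v (iota e) x -> connected_elt v (tau e) (x * tel e * vel r).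
Proof.
move=> [s hs ->]; exists (s ++ [:: lE e; lV r]); first exact: cw_edge.
by rewrite -[[:: _; _]]cat1s !word_class_cat mulgA.
Qed.

Lemma connected1 v : connected_elt v v 1.
Proof. by rewrite -(hom1 (@vel v)); apply: connected_vel. Qed.

Lemma connected_mulv u v x (r : Gv G v) :
  connected_elt u v x -> connected_elt u v (x * vel r).
Proof.
move=> h; move: v x h r; apply: connected_elt_ind => [r' r|x e r' hx _ r].
  by rewrite -gmulfM; apply: connected_vel.
by rewrite -mulgA -gmulfM; apply: connected_step.
Qed.

Lemma connectedM u v w x y :
  connected_elt u v x -> connected_elt v w y -> connected_elt u w (x * y).
Proof.
move=> hx h; move: w y h; apply: connected_elt_ind => [r|y e r _ IH].
  exact: connected_mulv.
by rewrite !mulgA; apply: connected_step.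
Qed.

Lemma connected_tel e : connected_elt (iota e) (tau e) (tel e).
Proof.
have -> : tel e = 1 * tel e * vel (1 : Gv G (tau e)).
  by rewrite hom1 mul1g mulg1.
exact/connected_step/connected1.
Qed.

Lemma connectedV v w x : connected_elt v w x -> connected_elt w v x^-1.
Proof.
move: w x; apply: connected_elt_ind => [r|x e r _ IH].
  by rewrite -homV; apply: connected_vel.
rewrite !invgM -homV; apply: connectedM (connected_vel _) _.
apply: connectedM IH; rewrite -tel_ebar.
have := connected_tel (ebar e); by rewrite {1}/iota ebarK.
Qed.

Definition pi1_pred (v : vertex G) : pred Pi :=
  fun x => `[< connected_elt v v x >].

Definition pi1 (v : vertex G) := {x : Pi | pi1_pred v x}.
HB.instance Definition _ v := SubChoice.on (pi1 v).

Lemma pi1_closed v : group_closed (pi1_pred v).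
Proof.
split=> [|x y]; rewrite !unfold_in; first exact/asboolP/connected1.
move=> /asboolP hx /asboolP hy; apply/asboolP.
by apply: connectedM hx _; apply: connectedV.
Qed.

HB.instance Definition _ v :=
  SubChoice_isSubGroup.Build Pi (pi1_pred v) (pi1 v) (@pi1_closed v).

Definition mk_pi1 v x (h : connected_elt v v x) : pi1 v :=
  exist _ x (introT (asboolP _) h).

Lemma pi1P v (x : pi1 v) : connected_elt v v (val x).
Proof. exact/asboolP/(valP x). Qed.
End PathGroup.

Arguments Pi_lift {G P} phiV phiE x.
Arguments tel {G} e.

Section Induced.
Variables (G : gog) (H : gog_aut G).

Definition Hstar_V (v : vertex G) (g : Gv G v) : Pi G := vel (Hv H v g).
Definition Hstar_E (e : edge G) : Pi G :=
  vel (delta H (ebar e)) * tel e * (vel (delta H e))^-1.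

Definition Hstar : Pi G -> Pi G := Pi_lift Hstar_V Hstar_E.

Lemma vel_delta_ebar e : vel (delta H (ebar (ebar e))) = vel (delta H e).
Proof. by case: e => u []. Qed.

Lemma Hstar_V_M v : {morph @Hstar_V v : x y / x * y}.
Proof. by move=> x y; rewrite /Hstar_V !gmulfM. Qed.

Lemma Hstar_E_ebar e : Hstar_E (ebar e) = (Hstar_E e)^-1.
Proof. by rewrite /Hstar_E vel_delta_ebar tel_ebar !invgM invgK mulgA. Qed.

Lemma Hstar_edge (e : edge G) (g : Ge G e.1) :
  Hstar_V (fe (ebar e) g) = ad (Hstar_E e) (Hstar_V (fe e g)).
Proof.
rewrite /Hstar_V /Hstar_E (aut_comm H (ebar e)) (aut_comm H e) /ad.
rewrite !velM !velV (vel_ebar (e := e)) /ad !invgM invgK !mulgA.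
by rewrite !mulgVK.
Qed.

Lemma HstarM : {morph Hstar : x y / x * y}.
Proof. exact: Pi_liftM Hstar_V_M Hstar_E_ebar Hstar_edge. Qed.

HB.instance Definition _ := isMultiplicative.Build _ _ Hstar HstarM.

Lemma Hstar_vel v (g : Gv G v) : Hstar (vel g) = vel (Hv H v g).
Proof. exact: Pi_lift_vel Hstar_V_M Hstar_E_ebar Hstar_edge _ _. Qed.

Lemma Hstar_tel e :
  Hstar (tel e) = vel (delta H (ebar e)) * tel e * (vel (delta H e))^-1.
Proof. exact: Pi_lift_tel Hstar_V_M Hstar_E_ebar Hstar_edge _. Qed.

Lemma Hstar_connected v w x :
  connected_elt v w x -> connected_elt v w (Hstar x).
Proof.
move: w x; apply: connected_elt_ind => [r|x e r _ IH].
  by rewrite Hstar_vel; apply: connected_vel.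
rewrite !HstarM Hstar_tel Hstar_vel -velV.
apply: connected_mulv; apply: connectedM IH _.
apply: connected_mulv; apply: connectedM (connected_vel _) _.
exact: connected_tel.
Qed.

Definition Hpi1 (v : vertex G) (x : pi1 v) : pi1 v :=
  mk_pi1 (Hstar_connected (pi1P x)).
End Induced.

Section BlowUp.
Variables (Gb : gog) (Hb : gog_aut Gb).
Variables (m : nat) (V : 'I_m -> vertex Gb).
Variables (Gs : 'I_m -> gog) (Hs : forall i, gog_aut (Gs i)).
Variables (p : forall i, vertex (Gs i)).
Variables (theta : forall i, grp_iso (Gv Gb (V i)) (pi1 (p i))).

Definition compatible (i : 'I_m) : Prop :=
  forall (E : edge Gb) (hE : tau E = V i),
  exists (v : vertex (Gs i)) (gamma : Pi (Gs i)),
  [/\ connected_elt (p i) v gamma,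
      forall g : Ge Gb E.1, exists x : Gv (Gs i) v,
        val (theta i (castv hE (fe E g))) = gamma * vel x * gamma^-1
    & exists y : Gv (Gs i) v,
        Hstar (Hs i) gamma^-1 * val (theta i (castv hE (delta Hb E))) * gamma
        = vel y].

Definition other_vertex := {W : vertex Gb | W \notin codom V}.

Variables (G : gog) (H : gog_aut G).

(* The equalities between groups that occur in the notions of
   sub-graph-of-groups and of quotient are rendered as identifications, that
   is, as isomorphisms (sub_v, sub_e, quo_v, quo_e) through which all the
   remaining data correspond.
   In att_fe and att_delta, e = quoE E, and x, y are f_e(g), delta(e) seen in
   the vertex group of Gs i; the two conditions are equations in Pi (Gs i), on
   which H_* is Hstar (Hs i). *)
Record blowup := Blowup {
  subV : forall i, vertex (Gs i) -> vertex G;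
  subE : forall i, edge_map (Gs i) G;
  quoV : other_vertex -> vertex G;
  quoE : edge_map Gb G;
  vertex_bij : bijective (fun x : other_vertex + {i & vertex (Gs i)} =>
    match x with inl W => quoV W | inr iv => subV (projT2 iv) end);
  gedge_bij : bijective (fun x : gedge Gb + {i & gedge (Gs i)} =>
    match x with
    | inl u => em_gedge quoE u
    | inr iu => em_gedge (subE (projT1 iu)) (projT2 iu)
    end);

  sub_tau : forall i (e : edge (Gs i)), subV (tau e) = tau (subE i e);
  sub_v : forall i v, grp_iso (Gv (Gs i) v) (Gv G (subV v));
  sub_e : forall i u, grp_iso (Ge (Gs i) u) (Ge G (em_gedge (subE i) u));
  sub_fe : forall i (e : edge (Gs i)) (g : Ge (Gs i) e.1),
    fe (subE i e) (sub_e e.1 g) = castv (sub_tau e) (sub_v (tau e) (fe e g));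

  sub_Hv : forall i v (x : Gv (Gs i) v),
    Hv H (subV v) (sub_v v x) = sub_v v (Hv (Hs i) v x);
  sub_He : forall i u (g : Ge (Gs i) u),
    He H (em_gedge (subE i) u) (sub_e u g) = sub_e u (He (Hs i) u g);
  sub_delta : forall i (e : edge (Gs i)),
    delta H (subE i e) = castv (sub_tau e) (sub_v (tau e) (delta (Hs i) e));

  quo_v : forall W : other_vertex, grp_iso (Gv Gb (val W)) (Gv G (quoV W));
  quo_e : forall u, grp_iso (Ge Gb u) (Ge G (em_gedge quoE u));
  quo_Hv : forall (W : other_vertex) (x : Gv Gb (val W)),
    Hv H (quoV W) (quo_v W x) = quo_v W (Hv Hb (val W) x);
  quo_He : forall u (g : Ge Gb u),
    He H (em_gedge quoE u) (quo_e u g) = quo_e u (He Hb u g);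

  quo_tau : forall (E : edge Gb) (hE : tau E \notin codom V),
    quoV (exist _ (tau E) hE) = tau (quoE E);
  quo_fe : forall (E : edge Gb) (hE : tau E \notin codom V) (g : Ge Gb E.1),
    fe (quoE E) (quo_e E.1 g)
    = castv (quo_tau hE) (quo_v (exist _ (tau E) hE) (fe E g));
  quo_delta : forall (E : edge Gb) (hE : tau E \notin codom V),
    delta H (quoE E)
    = castv (quo_tau hE) (quo_v (exist _ (tau E) hE) (delta Hb E));

  att_v : forall i (E : edge Gb), tau E = V i -> vertex (Gs i);
  att_tau : forall i (E : edge Gb) (hE : tau E = V i),
    subV (att_v hE) = tau (quoE E);
  att_gamma : forall i (E : edge Gb), tau E = V i -> Pi (Gs i);
  att_connected : forall i (E : edge Gb) (hE : tau E = V i),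
    connected_elt (p i) (att_v hE) (att_gamma hE);
  att_fe : forall i (E : edge Gb) (hE : tau E = V i) (g : Ge Gb E.1),
    exists2 x : Gv (Gs i) (att_v hE),
      fe (quoE E) (quo_e E.1 g) = castv (att_tau hE) (sub_v (att_v hE) x)
    & val (theta i (castv hE (fe E g))) = ad (att_gamma hE) (vel x);
  att_delta : forall i (E : edge Gb) (hE : tau E = V i),
    exists2 y : Gv (Gs i) (att_v hE),
      delta H (quoE E) = castv (att_tau hE) (sub_v (att_v hE) y)
    & val (theta i (castv hE (delta Hb E)))
      = Hstar (Hs i) (att_gamma hE) * vel y * (att_gamma hE)^-1 }.

Definition blown_up (W : vertex Gb) : {i | W = V i} + {W \notin codom V}.
Proof.
case: (boolP (W \in codom V)) => hW; last by right.
by left; exists (iinv hW); rewrite f_iinv.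
Defined.

Section Theta.
Variable B : blowup.

Definition incl_V i (v : vertex (Gs i)) (x : Gv (Gs i) v) : Pi G :=
  vel (sub_v B v x).
Definition incl_E i (e : edge (Gs i)) : Pi G := tel (subE B i e).
Definition incl i : Pi (Gs i) -> Pi G := Pi_lift (@incl_V i) (@incl_E i).

Definition basepoint (W : vertex Gb) : vertex G :=
  match blown_up W with
  | inleft (exist i _) => subV B (p i)
  | inright h => quoV B (exist _ W h)
  end.

Definition gamma (E : edge Gb) : Pi G :=
  match blown_up (tau E) with
  | inleft (exist i h) => incl (att_gamma B h)
  | inright _ => 1
  end.

Definition Theta_V (W : vertex Gb) (g : Gv Gb W) : Pi G :=
  match blown_up W with
  | inleft (exist i h) => incl (val (theta i (castv h g)))
  | inright h => vel (quo_v B (exist _ W h) g)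
  end.

Definition Theta_E (E : edge Gb) : Pi G :=
  gamma (ebar E) * tel (quoE B E) * (gamma E)^-1.

Definition Theta : Pi Gb -> Pi G := Pi_lift Theta_V Theta_E.

Lemma vel_castv (K : gog) (v w : vertex K) (h : v = w) (x : Gv K v) :
  vel (castv h x) = vel x.
Proof. by case: w / h. Qed.

Lemma castvM (K : gog) (v w : vertex K) (h : v = w) :
  {morph @castv K v w h : x y / x * y}.
Proof. by case: w / h. Qed.

Lemma tel_edge_map_ebar (A : gog) (j : edge_map A G) e :
  tel (j (ebar e)) = (tel (j e))^-1.
Proof. by rewrite edge_map_ebar tel_ebar. Qed.

Lemma vel_fe_edge_map_ebar (A : gog) (j : edge_map A G) (e : edge A)
    (g : Ge G (em_gedge j e.1)) :
  vel (fe (j (ebar e)) g) = ad (tel (j e)) (vel (fe (j e) g)).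
Proof.
rewrite -(vel_ebar (e := j e)).
have h b b' : b = b' -> vel (fe ((em_gedge j e.1, b) : edge G) g)
                      = vel (fe ((em_gedge j e.1, b') : edge G) g) by move=> ->.
by apply: h; rewrite /= addbN.
Qed.

Lemma incl_V_M i v : {morph @incl_V i v : x y / x * y}.
Proof. by move=> x y; rewrite /incl_V !gmulfM. Qed.

Lemma incl_E_ebar i e : @incl_E i (ebar e) = (incl_E e)^-1.
Proof. exact: tel_edge_map_ebar. Qed.

Lemma incl_edge i (e : edge (Gs i)) (g : Ge (Gs i) e.1) :
  incl_V (fe (ebar e) g) = ad (incl_E e) (incl_V (fe e g)).
Proof.
have hf e' (g' : Ge (Gs i) e'.1) :
    incl_V (fe e' g') = vel (fe (subE B i e') (sub_e B e'.1 g')).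
  by rewrite sub_fe vel_castv.
by rewrite !hf vel_fe_edge_map_ebar.
Qed.

Lemma inclM i : {morph @incl i : x y / x * y}.
Proof. exact: Pi_liftM (@incl_V_M i) (@incl_E_ebar i) (@incl_edge i). Qed.

HB.instance Definition _ i := isMultiplicative.Build _ _ (@incl i) (@inclM i).

Lemma inclV i : {morph @incl i : x / x^-1}.
Proof. exact: homV. Qed.

Lemma incl_vel i v (x : Gv (Gs i) v) : incl (vel x) = vel (sub_v B v x).
Proof. exact: Pi_lift_vel (@incl_V_M i) (@incl_E_ebar i) (@incl_edge i) _ _. Qed.

Lemma incl_tel i (e : edge (Gs i)) : incl (tel e) = tel (subE B i e).
Proof. exact: Pi_lift_tel (@incl_V_M i) (@incl_E_ebar i) (@incl_edge i) _. Qed.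

Lemma incl_connected i v w (x : Pi (Gs i)) :
  connected_elt v w x -> connected_elt (subV B v) (subV B w) (incl x).
Proof.
move: w x; apply: connected_elt_ind => [r|x e r _ IH].
  by rewrite incl_vel; apply: connected_vel.
rewrite !inclM incl_tel incl_vel; apply: connected_mulv.
apply: connectedM IH _; rewrite {1}/iota !sub_tau edge_map_ebar.
exact: connected_tel.
Qed.

Lemma Theta_V_M W : {morph @Theta_V W : x y / x * y}.
Proof.
move=> x y; rewrite /Theta_V; case: (blown_up W) => [[i h]|h].
  by rewrite castvM !gmulfM.
by rewrite !gmulfM.
Qed.

Lemma Theta_E_ebar E : Theta_E (ebar E) = (Theta_E E)^-1.
Proof. by rewrite /Theta_E ebarK tel_edge_map_ebar !invgM invgK mulgA. Qed.

Lemma Theta_V_fe (E : edge Gb) (g : Ge Gb E.1) :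
  Theta_V (fe E g) = ad (gamma E) (vel (fe (quoE B E) (quo_e B E.1 g))).
Proof.
rewrite /Theta_V /gamma; case: (blown_up (tau E)) => [[i h]|h].
  have [x -> ->] := att_fe B h g.
  by rewrite /ad !inclM inclV incl_vel vel_castv.
by rewrite (quo_fe B h) vel_castv /ad mul1g invg1 mulg1.
Qed.

Lemma Theta_edge (E : edge Gb) (g : Ge Gb E.1) :
  Theta_V (fe (ebar E) g) = ad (Theta_E E) (Theta_V (fe E g)).
Proof.
rewrite !Theta_V_fe vel_fe_edge_map_ebar /ad /Theta_E !invgM invgK !mulgA.
by rewrite !mulgVK.
Qed.

Lemma ThetaM : {morph Theta : x y / x * y}.
Proof. exact: Pi_liftM Theta_V_M Theta_E_ebar Theta_edge. Qed.

HB.instance Definition _ := isMultiplicative.Build _ _ Theta ThetaM.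

Lemma Theta_vel W (g : Gv Gb W) : Theta (vel g) = Theta_V g.
Proof. exact: Pi_lift_vel Theta_V_M Theta_E_ebar Theta_edge _ _. Qed.

Lemma Theta_tel E : Theta (tel E) = Theta_E E.
Proof. exact: Pi_lift_tel Theta_V_M Theta_E_ebar Theta_edge _. Qed.

Lemma Theta_V_connected W (g : Gv Gb W) :
  connected_elt (basepoint W) (basepoint W) (Theta_V g).
Proof.
rewrite /basepoint /Theta_V; case: (blown_up W) => [[i h]|h].
  exact/incl_connected/pi1P.
exact: connected_vel.
Qed.

Lemma gamma_connected E :
  connected_elt (basepoint (tau E)) (tau (quoE B E)) (gamma E).
Proof.
rewrite /basepoint /gamma; case: (blown_up (tau E)) => [[i h]|h].
  by rewrite -(att_tau B h); apply/incl_connected/att_connected.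
by rewrite quo_tau; apply: connected1.
Qed.

Lemma Theta_connected W W' x :
  connected_elt W W' x -> connected_elt (basepoint W) (basepoint W') (Theta x).
Proof.
move: W' x; apply: connected_elt_ind => [r|x E r _ IH].
  by rewrite Theta_vel; apply: Theta_V_connected.
rewrite !ThetaM Theta_vel Theta_tel.
apply: connectedM (Theta_V_connected _); apply: connectedM IH _.
apply: connectedM (connectedV (gamma_connected E)).
apply: connectedM (gamma_connected _) _.
by rewrite edge_map_ebar; apply: connected_tel.
Qed.

Definition Theta_pi1 (W : vertex Gb) (x : pi1 W) : pi1 (basepoint W) :=
  mk_pi1 (Theta_connected (pi1P x)).
End Theta.

(* The outer automorphisms induced by Hb and by H agree via Theta, which is an
   isomorphism of fundamental groups; base points are the vertices W of Gb. *)
Definition outer_agree (B : blowup) : Prop :=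
  forall W : vertex Gb,
    bijective (@Theta_pi1 B W) /\
    outer_eq (@Theta_pi1 B W \o @Hpi1 Gb Hb W)
             (@Hpi1 G H (basepoint B W) \o @Theta_pi1 B W).
End BlowUp.

Arguments other_vertex {Gb m} V.
Arguments compatible {Gb} Hb {m V Gs} Hs {p} theta i.
Arguments blowup {Gb} Hb {m V Gs} Hs {p} theta {G} H.

(* Main.v *)
From HB Require Import structures.
From mathcomp Require Import all_boot boolp.
Require Import Defs.

(** One direction only reads the data off: in a blow-up, the end of an edge E
    with tau E = V_i is attached at a vertex of G_i, and the elements of the
    vertex group which give f_e and delta(e) there are, after conjugation by
    gamma_E, the witnesses that compatibility asks for.

    Conversely, replace each V_i in the graph by the graph of G_i and attach
    the end of E at the vertex v(E) that compatibility provides.  Compatibility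
    says that the elements of Pi(G_i) that f_e(g) and delta(e) have to be,
    namely gamma_E^-1 theta_i(f_E(g)) gamma_E and
    H_*(gamma_E)^-1 theta_i(delta(E)) gamma_E, come from the vertex group at
    v(E).  For f_e to be a homomorphism, and for the identity
    H_v f_e = ad_delta(e) f_e H_e to hold in the vertex group and not just in
    Pi(G_i), the vertex groups have to embed in the path group ([vel_inj]);
    both properties are then inherited from f_E and the identity for E.

    The embedding is where graph-of-groups theory enters.  It is shown by
    letting the path group act on a set on which each vertex group acts freely:
    for every edge, a permutation has to conjugate one free action of the edge
    group into another, and an equivariant version of the Cantor-Bernstein
    theorem provides it ([conjugating_permutation]).

    That the outer automorphisms agree holds for every blow-up
    ([blowup_outer_agree]).  On generators one checks the exact equality
    Theta o Hb_* = H_* o Theta, so that the conjugating element is 1.  That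
    Theta is bijective on fundamental groups is shown by a homomorphism
    Psi : Pi(G) -> Pi(Gb) in the opposite direction.  It depends on a choice of
    elements c_v of Pi(G_i) leading from p_i to each vertex v, which turn an
    element x of Pi(G_i) going from v to w into the element c_v x c_w^-1 of
    pi_1(G_i, p_i), on which theta_i^-1 is defined.  Then Psi o Theta is the
    identity, and Theta o Psi sends an element z from v to w to c_v z c_w^-1,
    which is z itself when v and w are base points. *)

Set Implicit Arguments.
Unset Strict Implicit.
Unset Printing Implicit Defensive.

Local Open Scope group_scope.

(** * Conjugating two free actions of a group *)

Section EquivariantCantorBernstein.
Variables (A : groupType) (X : Type) (alpha beta : A -> X -> X).
Variables (f h : X -> X).
Hypothesis alphaK : forall g, cancel (alpha g) (alpha g^-1).
Hypothesis f_inj : injective f.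
Hypothesis h_inj : injective h.
Hypothesis f_equiv : forall g x, f (alpha g x) = beta g (f x).
Hypothesis h_equiv : forall g x, h (beta g x) = alpha g (h x).

(** The points on which the bijection is f; on the other points, all of which
    lie in the range of h, it is the inverse of h. *)
Inductive cb_chain : X -> Prop :=
| cb_start x : (forall y, x <> h y) -> cb_chain x
| cb_next x : cb_chain x -> cb_chain (h (f x)).

Lemma cb_chain_equiv g x : cb_chain x -> cb_chain (alpha g x).
Proof.
elim=> {x} [x nx|x _ IH]; last by rewrite -h_equiv -f_equiv; apply: cb_next.
apply: cb_start => y /(congr1 (alpha g^-1)); rewrite alphaK -h_equiv.
exact: nx.
Qed.

(** The classical bijection is built from f and h without any choice, so it is
    equivariant as soon as f and h are. *)
Lemma equivariant_Cantor_Bernstein :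
  exists t t' : X -> X,
  [/\ cancel t t', cancel t' t & forall g x, t (alpha g x) = beta g (t x)].
Proof.
have /choice[t tP] x :
    exists y, cb_chain x /\ y = f x \/ ~ cb_chain x /\ x = h y.
  have [cx|ncx] := pselect (cb_chain x); first by exists (f x); left.
  have [y xy] : exists y, x = h y.
    by apply: contrapT => nx; apply/ncx/cb_start => y xy; apply: nx; exists y.
  by exists y; right.
have t_inj : injective t.
  move=> x y txy; case: (tP x) (tP y) => [[cx tx]|[cx tx]] [[cy ty]|[cy ty]].
  - by apply: f_inj; rewrite -tx -ty.
  - by case: cy; rewrite ty -txy tx; apply: cb_next.
  - by case: cx; rewrite tx txy ty; apply: cb_next.
  - by rewrite tx ty txy.
have /choice[t' tK'] y : exists x, t x = y.
  case: (tP (h y)) => [[cy _]|[_ /h_inj e]]; last by exists (h y).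
  (* A point h y of the chain is not a start, hence is h (f x), so y = f x. *)
  move ez: (h y) cy => z cz; case: cz ez => [x nx /esym/nx //|x cx /h_inj ->].
  by exists x; case: (tP x) => [[_ ->]|[/(_ cx)]].
exists t, t'; split=> // [x|g x]; first exact: t_inj.
case: (tP x) (tP (alpha g x)) => [[cx tx]|[cx tx]] [[cy ty]|[cy ty]].
- by rewrite ty tx f_equiv.
- by case: cy; apply: cb_chain_equiv.
- by case: cx; rewrite -(alphaK g x); apply: cb_chain_equiv.
- by apply: h_inj; rewrite -ty h_equiv -tx.
Qed.
End EquivariantCantorBernstein.

Section HNN.
Variables (M A : groupType).

(** Picking a representative r k in every coset a(A) k; the A-coordinate d is
    well defined because a is injective. *)
Lemma coset_split (a : {multiplicative A -> M}) : injective a ->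
  exists (d : M -> A) (r : M -> M),
  [/\ forall k, k = a (d k) * r k,
      forall g k, d (a g * k) = g * d k
    & forall g k, r (a g * k) = r k].
Proof.
move=> a_inj; pose coset k z := `[< exists g, k = a g * z >].
pose r k := choose (coset k) k.
have rP k : coset k (r k).
  by apply: chooseP; apply/asboolP; exists 1; rewrite hom1 mul1g.
have /choice[d dP] k : exists g, k = a g * r k by apply/asboolP/rP.
have r_coset g k : r (a g * k) = r k.
  rewrite /r; have <- : coset k = coset (a g * k).
    apply: funext => z; apply: asbool_equiv_eq; split=> [[u ->]|[u ku]].
      by exists (g * u); rewrite gmulfM mulgA.
    by exists (g^-1 * u); rewrite gmulfM homV -mulgA -ku mulKg.
  apply: choose_id; apply/asboolP; last by exists 1; rewrite hom1 mul1g.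
  by exists g^-1; rewrite homV mulKg.
exists d, r; split=> // g k; apply: a_inj; apply: (mulIg (r k)).
by rewrite gmulfM -{1}(r_coset g) -dP -mulgA -dP.
Qed.

(** The sequence stores the coset representatives that are used up by
    [equivariant_injection]; it can absorb one more of them, whatever the
    cardinals of the coset spaces. *)
Definition tracks : Type := M * (nat -> M).
Definition shift_act (k : M) (x : tracks) : tracks := (k * x.1, x.2).

(** Write k = a(g) r with r a representative: replace k by b(g), and remember r
    by pushing it onto the sequence. *)
Lemma equivariant_injection (a b : {multiplicative A -> M}) :
    injective a -> injective b ->
  exists2 f : tracks -> tracks, injective f
    & forall g x, f (shift_act (a g) x) = shift_act (b g) (f x).
Proof.
move=> /coset_split[d [r [drE dM rM]]] b_inj.
exists (fun x => (b (d x.1), fun n => if n is n'.+1 then x.2 n' else r x.1)).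
  move=> [k s] [k' s'] /= [/b_inj dk /funeqP rs].
  congr pair; first by rewrite (drE k) (drE k') dk (rs 0).
  by apply: funext => n; apply: (rs n.+1).
move=> g [k s]; rewrite /shift_act /= dM gmulfM rM; by [].
Qed.

(** This is what makes a stable letter of an HNN extension act on [tracks M]. *)
Lemma conjugating_permutation (a b : {multiplicative A -> M}) :
    injective a -> injective b ->
  exists t t' : tracks -> tracks,
  [/\ cancel t t', cancel t' t
    & forall g x, t (shift_act (a g) x) = shift_act (b g) (t x)].
Proof.
move=> a_inj b_inj; have [f f_inj fE] := equivariant_injection a_inj b_inj.
have [h h_inj hE] := equivariant_injection b_inj a_inj.
have actK (c : {multiplicative A -> M}) g :
    cancel (shift_act (c g)) (shift_act (c g^-1)).
  by case=> k s; rewrite /shift_act homV /= mulKg.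
exact: (equivariant_Cantor_Bernstein (actK a) f_inj h_inj fE hE).
Qed.
End HNN.

(** * Vertex groups embed in the path group *)

Lemma castv_id (G : gog) (v : vertex G) (h : v = v) (x : Gv G v) :
  castv h x = x.
Proof. by rewrite (eq_irrelevance h erefl). Qed.

Lemma castv_inj (G : gog) (v w : vertex G) (h : v = w) :
  injective (@castv G v w h).
Proof. by case: w / h. Qed.

Lemma castvV (G : gog) (v w : vertex G) (h : v = w) :
  {morph @castv G v w h : x / x^-1}.
Proof. by case: w / h. Qed.

Lemma castv_Hv (G : gog) (H : gog_aut G) (v w : vertex G) (h : v = w)
    (x : Gv G v) :
  castv h (Hv H v x) = Hv H w (castv h x).
Proof. by case: w / h. Qed.

Section VertexProduct.
Variable G : gog.

(** A single group in which all the vertex groups embed, so that the edge groups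
    embed in it twice. *)
Definition vertex_prod : Type := forall v : vertex G, Gv G v.

HB.instance Definition _ := gen_eqMixin vertex_prod.
HB.instance Definition _ := gen_choiceMixin vertex_prod.

Implicit Types x y z : vertex_prod.
Definition vprod_one : vertex_prod := fun v => 1.
Definition vprod_mul x y : vertex_prod := fun v => x v * y v.
Definition vprod_inv x : vertex_prod := fun v => (x v)^-1.

Lemma vprod_mulA : associative vprod_mul.
Proof.
by move=> x y z; apply: functional_extensionality_dep => v; apply: mulgA.
Qed.

Lemma vprod_mul1 : left_id vprod_one vprod_mul.
Proof.
by move=> x; apply: functional_extensionality_dep => v; apply: mul1g.
Qed.

Lemma vprod_mulr1 : right_id vprod_one vprod_mul.
Proof.
by move=> x; apply: functional_extensionality_dep => v; apply: mulg1.
Qed.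

Lemma vprod_mulV : left_inverse vprod_one vprod_inv vprod_mul.
Proof.
by move=> x; apply: functional_extensionality_dep => v; apply: mulVg.
Qed.

Lemma vprod_mulrV : right_inverse vprod_one vprod_inv vprod_mul.
Proof.
by move=> x; apply: functional_extensionality_dep => v; apply: mulgV.
Qed.

HB.instance Definition _ := isGroup.Build vertex_prod
  vprod_mulA vprod_mul1 vprod_mulr1 vprod_mulV vprod_mulrV.

Definition at_vertex v (x : Gv G v) : vertex_prod :=
  fun w => if v =P w is ReflectT h then castv h x else 1.

Lemma at_vertexE v (x : Gv G v) : at_vertex x v = x.
Proof. by rewrite /at_vertex; case: eqP => // h; rewrite castv_id. Qed.

Lemma at_vertexM v : {morph @at_vertex v : x y / x * y}.
Proof.
move=> x y; apply: functional_extensionality_dep => w.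
change (at_vertex (x * y) w = at_vertex x w * at_vertex y w).
by rewrite /at_vertex; case: eqP => [h|_]; rewrite ?castvM ?mulg1.
Qed.

HB.instance Definition _ v :=
  isMultiplicative.Build _ _ (@at_vertex v) (@at_vertexM v).

Lemma at_vertex_inj v : injective (@at_vertex v).
Proof.
by move=> x y /(congr1 (fun z : vertex_prod => z v)); rewrite !at_vertexE.
Qed.

Let X := tracks vertex_prod.

(** Words act on [tracks vertex_prod]: a vertex group acts by left
    multiplication, which is faithful, and t_e as a permutation that conjugates
    the action of G_e through f_e into its action through f_(ebar e).  The
    relations of the path group hold in this action. *)
Lemma vel_inj v : injective (@vel G v).
Proof.
have /choice[t /choice[t' tP]] u : exists (t t' : X -> X),
    [/\ cancel t t', cancel t' t
      & forall (g : Ge G u) (x : X),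
          t (shift_act (at_vertex (fe (u, true) g)) x)
          = shift_act (at_vertex (fe (u, false) g)) (t x)].
  have ab_inj b : injective (at_vertex (v := _) \o fe ((u, b) : edge G)).
    exact: inj_comp (@at_vertex_inj _) (@fe_inj _ _).
  exact: (conjugating_permutation (ab_inj true) (ab_inj false)).
pose act_letter (l : letter G) : X -> X :=
  match l with
  | inl vx => shift_act (at_vertex (projT2 vx))
  | inr e => if e.2 then t e.1 else t' e.1
  end.
pose act (s : word G) (x : X) := foldr act_letter x s.
have act_eq s1 s2 : word_eq s1 s2 -> act s1 =1 act s2.
  rewrite /act; elim=> {s1 s2} //=.
  - by move=> s1 s2 _ IH x; rewrite IH.
  - by move=> s1 s2 s3 _ h1 _ h2 x; rewrite h1.
  - by move=> s1 s2 r1 r2 _ h1 _ h2 x; rewrite !foldr_cat h1 h2.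
  - by move=> w [k s]; rewrite /shift_act hom1 mul1g.
  - by move=> w x y [k s]; rewrite /shift_act gmulfM /= mulgA.
  - by move=> [u b] x /=; case: (tP u) b => tK tK' _ [] /=.
  - move=> [u b] /= g x; case: (tP u) b g => tK tK' tE [] /= g.
      by rewrite tE tK'.
    by apply: (can_inj tK); rewrite tE !tK'.
(* Left multiplication is determined by its value at 1. *)
move=> x y /word_classE/act_eq/(_ (1, fun=> 1)).
rewrite /act /= /shift_act /= !mulg1 => -[]; exact: at_vertex_inj.
Qed.
End VertexProduct.

(** * Path groups and connecting elements *)

Lemma Pi_hom_eq (G : gog) (P : groupType)
    (phi psi : {multiplicative Pi G -> P}) :
    (forall v (g : Gv G v), phi (vel g) = psi (vel g)) ->
    (forall e, phi (tel e) = psi (tel e)) ->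
  phi =1 psi.
Proof.
move=> hV hE x; rewrite -[x]word_class_repr; elim: (repr x) => [|l s IH].
  by rewrite word_class_nil !hom1.
rewrite -cat1s word_class_cat !gmulfM IH; congr (_ * _).
by case: l => [[v g]|e]; [apply: hV|apply: hE].
Qed.

Lemma connect_homo (T U : finType) (eT : rel T) (eU : rel U) (h : T -> U) :
    (forall x y, eT x y -> connect eU (h x) (h y)) ->
  forall x y, connect eT x y -> connect eU (h x) (h y).
Proof.
move=> hE x y /connectP[s + ->] {y}; elim: s x => //= y s IH x /andP[xy /IH].
exact: connect_trans (hE _ _ xy).
Qed.

Lemma connected_elt_exists (G : gog) (v w : vertex G) :
  exists x : Pi G, connected_elt v w x.
Proof.
have /connectP[s + ->] := graph_connected v w.
elim: s v {w} => [|w s IH] v /=; first by exists 1; apply: connected1.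
case/andP=> /existsP[e /andP[/eqP <- /eqP <-]] /IH[x hx].
by exists (tel e * x); apply: connectedM hx; apply: connected_tel.
Qed.

Lemma based_paths (G : gog) (v : vertex G) :
  exists c : vertex G -> Pi G,
    (forall w, connected_elt v w (c w)) /\ c v = 1.
Proof.
have /choice[c cP] w : exists x : Pi G, connected_elt v w x /\ (w = v -> x = 1).
  have [->|/eqP nwv] := eqVneq w v.
    by exists 1; split=> //; apply: connected1.
  by have [x hx] := connected_elt_exists v w; exists x.
by exists c; split=> [w|]; [case: (cP w)|apply: (cP v).2].
Qed.

(** * What holds in every blow-up *)

Section GivenBlowUp.
Variables (Gb : gog) (Hb : gog_aut Gb).
Variables (m : nat) (V : 'I_m -> vertex Gb).
Variables (Gs : 'I_m -> gog) (Hs : forall i, gog_aut (Gs i)).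
Variables (p : forall i, vertex (Gs i)).
Variables (theta : forall i, grp_iso (Gv Gb (V i)) (pi1 (p i))).
Hypothesis theta_comm : forall i (x : Gv Gb (V i)),
  theta i (Hv Hb (V i) x) = Hpi1 (Hs i) (theta i x).
Variables (G : gog) (H : gog_aut G) (B : blowup Hb Hs theta H).

Lemma compatible_blowup i : compatible Hb Hs theta i.
Proof.
move=> E hE; exists (att_v B hE), (att_gamma B hE); split.
- exact: att_connected.
- by move=> g; have [x _ ->] := att_fe B hE g; exists x.
have [y _ ->] := att_delta B hE; exists y.
by rewrite homV !mulgA mulVg mul1g mulgVK.
Qed.

Lemma incl_Hstar i (x : Pi (Gs i)) :
  incl B (Hstar (Hs i) x) = Hstar H (incl B x).
Proof.
move: x; refine (@Pi_hom_eq _ _ (incl B (i:=i) \o Hstar (Hs i))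
                          (Hstar H \o incl B (i:=i)) _ _) => [v g|e].
  by rewrite /= Hstar_vel !incl_vel Hstar_vel sub_Hv.
have hd e' : vel (delta H (subE B i e')) = incl B (vel (delta (Hs i) e')).
  by rewrite sub_delta vel_castv incl_vel.
rewrite /= Hstar_tel !inclM inclV incl_tel -!hd Hstar_tel.
by congr (_ * _ * _); rewrite edge_map_ebar.
Qed.

Lemma Theta_V_Hv W (g : Gv Gb W) :
  Theta_V B (Hv Hb W g) = Hstar H (Theta_V B g).
Proof.
rewrite /Theta_V; case: (blown_up V W) => [[i h]|h].
  by subst W; rewrite /castv /= theta_comm /= incl_Hstar.
by rewrite Hstar_vel -quo_Hv.
Qed.

(** Written with gamma, which is 1 away from the V_i, the conditions on delta(E)
    at both kinds of end take the same form. *)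
Lemma Theta_V_delta E :
  Theta_V B (delta Hb E)
  = Hstar H (gamma B E) * vel (delta H (quoE B E)) * (gamma B E)^-1.
Proof.
rewrite /Theta_V /gamma; case: (blown_up V (tau E)) => [[i h]|h].
  have [y -> ->] := att_delta B h.
  by rewrite !inclM inclV incl_vel vel_castv incl_Hstar.
by rewrite (quo_delta B h) vel_castv hom1 mul1g invg1 mulg1.
Qed.

(** An equality on the whole path group, with no inner automorphism: the two
    factors gamma in Theta(t_E) cancel against those in [Theta_V_delta]. *)
Lemma Theta_Hstar x : Theta B (Hstar Hb x) = Hstar H (Theta B x).
Proof.
move: x; refine (@Pi_hom_eq _ _ (Theta B \o Hstar Hb)
                          (Hstar H \o Theta B) _ _) => [v g|E].
  by rewrite /= Hstar_vel !Theta_vel Theta_V_Hv.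
have ThetaV : {morph Theta B : y / y^-1} by exact: homV.
have HstarV : {morph Hstar H : y / y^-1} by exact: homV.
rewrite /= Hstar_tel !ThetaM ThetaV !Theta_vel Theta_tel !Theta_V_delta.
rewrite /Theta_E !HstarM HstarV Hstar_tel.
have -> : vel (delta H (ebar (quoE B E))) = vel (delta H (quoE B (ebar E))).
  by rewrite edge_map_ebar.
by rewrite !invgM !invgK !mulgA !mulgVK.
Qed.
End GivenBlowUp.

(** * Theta is bijective on fundamental groups *)

Lemma grp_iso_can (G H : groupType) (f : grp_iso G H) :
  exists g : H -> G, cancel f g /\ cancel g f.
Proof. by case: (iso_bij f) => g fK gK; exists g. Qed.

Definition iso_inv (G H : groupType) (f : grp_iso G H) : H -> G :=
  projT1 (cid (grp_iso_can f)).

Lemma iso_funK (G H : groupType) (f : grp_iso G H) : cancel f (iso_inv f).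
Proof. by case: (projT2 (cid (grp_iso_can f))). Qed.

Lemma iso_invK (G H : groupType) (f : grp_iso G H) : cancel (iso_inv f) f.
Proof. by case: (projT2 (cid (grp_iso_can f))). Qed.

Lemma iso_invM (G H : groupType) (f : grp_iso G H) :
  {morph iso_inv f : x y / x * y}.
Proof. exact: can2_gmulfM (iso_funK f) (iso_invK f). Qed.

Section Inverse.
Variables (Gb : gog) (Hb : gog_aut Gb).
Variables (m : nat) (V : 'I_m -> vertex Gb).
Hypothesis V_inj : injective V.
Variables (Gs : 'I_m -> gog) (Hs : forall i, gog_aut (Gs i)).
Variables (p : forall i, vertex (Gs i)).
Variables (theta : forall i, grp_iso (Gv Gb (V i)) (pi1 (p i))).
Variables (G : gog) (H : gog_aut G) (B : blowup Hb Hs theta H).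

Definition glue (y : other_vertex V + {i & vertex (Gs i)}) : vertex G :=
  match y with
  | inl W => quoV B W
  | inr iv => subV B (projT2 iv)
  end.

Definition gglue (y : gedge Gb + {i & gedge (Gs i)}) : gedge G :=
  match y with
  | inl u => em_gedge (quoE B) u
  | inr iu => em_gedge (subE B (projT1 iu)) (projT2 iu)
  end.

Variables (unglue : vertex G -> other_vertex V + {i & vertex (Gs i)}).
Hypotheses (glueK : cancel glue unglue) (unglueK : cancel unglue glue).
Variables (gunglue : gedge G -> gedge Gb + {i & gedge (Gs i)}).
Hypotheses (gglueK : cancel gglue gunglue) (gunglueK : cancel gunglue gglue).
Variable c : forall i, vertex (Gs i) -> Pi (Gs i).
Hypothesis c_connected : forall i v, connected_elt (p i) v (c v).
Hypothesis c_base : forall i, c (p i) = 1.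

(** theta_i^-1 on the elements of pi_1(G_i, p_i); the default 1 elsewhere makes
    it a total function on Pi(G_i). *)
Definition pull i (x : Pi (Gs i)) : Pi Gb :=
  vel (iso_inv (theta i) (insubd 1 x)).

Lemma pull_val i (x : pi1 (p i)) : pull (val x) = vel (iso_inv (theta i) x).
Proof. by rewrite /pull valKd. Qed.

Lemma pullM i (x y : Pi (Gs i)) :
    connected_elt (p i) (p i) x -> connected_elt (p i) (p i) y ->
  pull (x * y) = pull x * pull y.
Proof.
move=> hx hy; pose x' := mk_pi1 hx; pose y' := mk_pi1 hy.
change (pull (val (x' * y')) = pull (val x') * pull (val y')).
by rewrite !pull_val iso_invM velM.
Qed.

Lemma pull1 i : pull (1 : Pi (Gs i)) = 1.
Proof.
apply: (mulgI (pull (1 : Pi (Gs i)))); rewrite -pullM ?mulg1 //;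
  exact: connected1.
Qed.

(** [blown_up] need not return the index i, whence the injectivity of V. *)
Lemma Theta_pull i (x : Pi (Gs i)) :
  connected_elt (p i) (p i) x -> Theta B (pull x) = incl B x.
Proof.
move=> hx; change (Theta B (pull (val (mk_pi1 hx))) = incl B (val (mk_pi1 hx))).
move: (mk_pi1 hx) => y {x hx}; rewrite pull_val Theta_vel /Theta_V.
case: (blown_up V (V i)) => [[j e]|h]; last by case/negP: (h); apply: codom_f.
have ij := V_inj e; case: j / ij e => e.
by rewrite castv_id iso_invK.
Qed.

(** Elements of Pi(G_i) that are not loops at p_i are first made so by means of
    c.  This is multiplicative on composable elements ([path_pullM]). *)
Definition path_pull i (v w : vertex (Gs i)) (x : Pi (Gs i)) : Pi Gb :=
  pull (c v * x * (c w)^-1).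

Lemma based_connected i (v w : vertex (Gs i)) x :
  connected_elt v w x -> connected_elt (p i) (p i) (c v * x * (c w)^-1).
Proof.
move=> hx; apply: connectedM (connectedV (c_connected w)).
exact: connectedM (c_connected v) hx.
Qed.

Lemma path_pullM i (v w u : vertex (Gs i)) x y :
    connected_elt v w x -> connected_elt w u y ->
  path_pull v u (x * y) = path_pull v w x * path_pull w u y.
Proof.
move=> hx hy; rewrite /path_pull -pullM; try exact: based_connected.
by rewrite !mulgA mulgVK.
Qed.

Lemma path_pull1 i (v : vertex (Gs i)) : path_pull v v 1 = 1.
Proof. by rewrite /path_pull mulg1 mulgV pull1. Qed.

Lemma path_pullV i (v w : vertex (Gs i)) x :
  connected_elt v w x -> path_pull w v x^-1 = (path_pull v w x)^-1.
Proof.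
move=> hx; apply: (mulgI (path_pull v w x)).
by rewrite -path_pullM ?mulgV ?path_pull1 //; apply: connectedV.
Qed.

Lemma Theta_path_pull i (v w : vertex (Gs i)) x :
    connected_elt v w x ->
  Theta B (path_pull v w x) = incl B (c v) * incl B x * (incl B (c w))^-1.
Proof.
by move=> hx; rewrite Theta_pull ?inclM ?inclV //; apply: based_connected.
Qed.

Lemma path_pull_connected i (v w : vertex (Gs i)) x :
  connected_elt (V i) (V i) (path_pull v w x).
Proof. exact: connected_vel. Qed.

(** Psi on the vertex group at a vertex given as an element of the sum; [Psi_V]
    transports it to the vertices of G. *)
Definition Psi_at (y : other_vertex V + {i & vertex (Gs i)}) :
    Gv G (glue y) -> Pi Gb :=
  match y return Gv G (glue y) -> Pi Gb with
  | inl W => fun g => vel (iso_inv (quo_v B W) g)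
  | inr (existT i v) => fun g => path_pull v v (vel (iso_inv (sub_v B v) g))
  end.

Definition Psi_V (x : vertex G) (g : Gv G x) : Pi Gb :=
  Psi_at (castv (esym (unglueK x)) g).

Lemma Psi_V_glue y (g : Gv G (glue y)) : Psi_V g = Psi_at g.
Proof.
rewrite /Psi_V; move: (esym _); rewrite glueK => h; by rewrite castv_id.
Qed.

Lemma Psi_V_quo (W : other_vertex V) (g : Gv Gb (val W)) :
  Psi_V (quo_v B W g) = vel g.
Proof.
by rewrite (Psi_V_glue (y := inl W) (quo_v B W g)) /= iso_funK.
Qed.

Lemma Psi_V_sub i (v : vertex (Gs i)) (g : Gv (Gs i) v) :
  Psi_V (sub_v B v g) = path_pull v v (vel g).
Proof.
pose y : other_vertex V + {i & vertex (Gs i)} := inr (existT _ i v).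
by rewrite (Psi_V_glue (y := y) (sub_v B v g)) /= iso_funK.
Qed.

Lemma Psi_V_castv x y (h : x = y) (g : Gv G x) : Psi_V (castv h g) = Psi_V g.
Proof. by case: y / h. Qed.

Lemma Psi_V_M x : {morph @Psi_V x : g h / g * h}.
Proof.
move=> g h; rewrite /Psi_V castvM.
case: (unglue x) (castv _ g) (castv _ h) => [W|[i v]] /= {}g {}h.
  by rewrite iso_invM velM.
by rewrite iso_invM velM (path_pullM (w := v)) //; apply: connected_vel.
Qed.

(** The image of gamma E under Psi, see [Psi_gamma]. *)
Definition gamma_pull (E : edge Gb) : Pi Gb :=
  match blown_up V (tau E) with
  | inleft (exist i h) => path_pull (p i) (att_v B h) (att_gamma B h)
  | inright _ => 1
  end.

(** Forced by Theta(t_E) = gamma(ebar E) t_e gamma(E)^-1 and Psi(Theta(t_E)) =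
    t_E. *)
Definition Psi_quo (E : edge Gb) : Pi Gb :=
  (gamma_pull (ebar E))^-1 * tel E * gamma_pull E.

Definition Psi_sub i (e : edge (Gs i)) : Pi Gb :=
  path_pull (iota e) (tau e) (tel e).

Definition Psi_E (e : edge G) : Pi Gb :=
  match gunglue e.1 with
  | inl u => Psi_quo (u, em_flip (quoE B) u (+) e.2)
  | inr (existT i u) =>
      Psi_sub ((u, em_flip (subE B i) u (+) e.2) : edge (Gs i))
  end.

Lemma Psi_E_quo E : Psi_E (quoE B E) = Psi_quo E.
Proof.
case: E => u b; rewrite /Psi_E -[(quoE B (u, b)).1]/(gglue (inl u)) gglueK.
by rewrite addKb.
Qed.

Lemma Psi_E_sub i (e : edge (Gs i)) : Psi_E (subE B i e) = Psi_sub e.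
Proof.
case: e => u b; rewrite /Psi_E.
rewrite -[(subE B i (u, b)).1]/(gglue (inr (existT _ i u))) gglueK.
by rewrite addKb.
Qed.

Lemma edge_cases (Q : edge G -> Prop) :
    (forall E, Q (quoE B E)) -> (forall i (e : edge (Gs i)), Q (subE B i e)) ->
  forall e, Q e.
Proof.
move=> hq hs [u b]; rewrite -(gunglueK u).
case: (gunglue u) => [v|[i v]] /=.
  by have := hq (v, em_flip (quoE B) v (+) b); rewrite /edge_map_fun /= addKb.
have := hs i (v, em_flip (subE B i) v (+) b).
by rewrite /edge_map_fun /= addKb.
Qed.

Lemma Psi_E_ebar e : Psi_E (ebar e) = (Psi_E e)^-1.
Proof.
elim/edge_cases: e => [E|i e]; rewrite -edge_map_ebar.
  by rewrite !Psi_E_quo /Psi_quo ebarK tel_ebar !invgM invgK mulgA.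
rewrite !Psi_E_sub /Psi_sub tel_ebar -path_pullV; last exact: connected_tel.
by rewrite /iota ebarK.
Qed.

Lemma Psi_V_fe_ebar (A : gog) (j : edge_map A G) (e : edge A)
    (g : Ge G (em_gedge j e.1)) :
  Psi_V (fe (ebar (j e)) g) = Psi_V (fe (j (ebar e)) g).
Proof.
have h b b' : b = b' -> Psi_V (fe ((em_gedge j e.1, b) : edge G) g)
                      = Psi_V (fe ((em_gedge j e.1, b') : edge G) g).
  by move=> ->.
by apply: h; rewrite /= addbN.
Qed.

(** The image under Psi of the relation theta_i o f_E = ad_gamma_E o f_e. *)
Lemma Psi_V_fe_quo (E : edge Gb) (g : Ge Gb E.1) :
  Psi_V (fe (quoE B E) (quo_e B E.1 g)) = ad (gamma_pull E)^-1 (vel (fe E g)).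
Proof.
rewrite /gamma_pull /ad invgK.
case: (blown_up V (tau E)) => [[i h]|h]; last first.
  by rewrite (quo_fe B h) Psi_V_castv Psi_V_quo invg1 mul1g mulg1.
have [x -> tx] := att_fe B h g; rewrite Psi_V_castv Psi_V_sub.
have hc := att_connected B h.
have <- : path_pull (p i) (p i) (val (theta i (castv h (fe E g))))
    = vel (fe E g).
  by rewrite /path_pull c_base mul1g invg1 mulg1 pull_val iso_funK vel_castv.
have hV := connectedV hc; have hx := connected_vel x.
have hp := connectedM (connectedM hc hx) hV.
rewrite -path_pullV // tx -(path_pullM hV hp).
rewrite -(path_pullM (connectedM hV hp) hc).
by rewrite !mulgA mulVg mul1g mulgVK.
Qed.

Lemma Psi_V_fe_sub i (e : edge (Gs i)) (g : Ge (Gs i) e.1) :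
  Psi_V (fe (subE B i e) (sub_e B e.1 g))
  = path_pull (tau e) (tau e) (vel (fe e g)).
Proof. by rewrite sub_fe Psi_V_castv Psi_V_sub. Qed.

Lemma Psi_edge (e : edge G) (g : Ge G e.1) :
  Psi_V (fe (ebar e) g) = ad (Psi_E e) (Psi_V (fe e g)).
Proof.
elim/edge_cases: e g => [E|i e] g; rewrite Psi_V_fe_ebar.
  rewrite -(iso_invK (quo_e B E.1) g) (Psi_V_fe_quo (E := ebar E)) Psi_V_fe_quo.
  rewrite Psi_E_quo /Psi_quo vel_ebar /ad !invgM !invgK !mulgA.
  by rewrite !(mulgVK, mulgK).
rewrite -(iso_invK (sub_e B e.1) g) (Psi_V_fe_sub (e := ebar e)) Psi_V_fe_sub.
rewrite Psi_E_sub /Psi_sub vel_ebar /ad -path_pullV; last exact: connected_tel.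
have ht := connected_tel e.
have hx := connected_vel (fe e (iso_inv (sub_e B e.1) g)).
by rewrite -(path_pullM ht hx) -(path_pullM (connectedM ht hx) (connectedV ht)).
Qed.

Definition Psi : Pi G -> Pi Gb := Pi_lift Psi_V Psi_E.

Lemma PsiM : {morph Psi : x y / x * y}.
Proof. exact: Pi_liftM Psi_V_M Psi_E_ebar Psi_edge. Qed.

HB.instance Definition _ := isMultiplicative.Build _ _ Psi PsiM.

Lemma PsiV : {morph Psi : x / x^-1}.
Proof. exact: homV. Qed.

Lemma Psi_vel v (g : Gv G v) : Psi (vel g) = Psi_V g.
Proof. exact: Pi_lift_vel Psi_V_M Psi_E_ebar Psi_edge _ _. Qed.

Lemma Psi_tel e : Psi (tel e) = Psi_E e.
Proof. exact: Pi_lift_tel Psi_V_M Psi_E_ebar Psi_edge _. Qed.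

Lemma Psi_incl i (v w : vertex (Gs i)) x :
  connected_elt v w x -> Psi (incl B x) = path_pull v w x.
Proof.
move: w x; apply: connected_elt_ind => [r|x e r hx IH].
  by rewrite incl_vel Psi_vel Psi_V_sub.
have ht := connected_tel e.
rewrite !inclM !PsiM incl_vel incl_tel Psi_vel Psi_tel Psi_V_sub Psi_E_sub IH.
rewrite (path_pullM (w := tau e)) ?(path_pullM (w := iota e)) //.
  exact: connectedM ht.
exact: connected_vel.
Qed.

Lemma Psi_gamma E : Psi (gamma B E) = gamma_pull E.
Proof.
rewrite /gamma /gamma_pull; case: (blown_up V (tau E)) => [[i h]|h].
  exact/Psi_incl/att_connected.
exact: hom1.
Qed.

Lemma Psi_Theta x : Psi (Theta B x) = x.
Proof.
move: x; refine (@Pi_hom_eq _ _ (Psi \o Theta B) idfun _ _) => [W g|E] /=.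
  rewrite Theta_vel /Theta_V; case: (blown_up V W) => [[i h]|h]; last first.
    by rewrite Psi_vel Psi_V_quo.
  rewrite (Psi_incl (pi1P _)) /path_pull c_base mul1g invg1 mulg1 pull_val.
  by rewrite iso_funK vel_castv.
rewrite Theta_tel /Theta_E !PsiM PsiV !Psi_gamma Psi_tel Psi_E_quo /Psi_quo.
by rewrite !mulgA mulgV mul1g mulgK.
Qed.

(** The factor by which Theta o Psi differs from the identity at x, see
    [Theta_Psi]. *)
Definition spoke (x : vertex G) : Pi G :=
  match unglue x with
  | inl _ => 1
  | inr (existT i v) => incl B (c v)
  end.

Definition collapse (x : vertex G) : vertex Gb :=
  match unglue x with
  | inl W => val W
  | inr (existT i _) => V i
  end.

Lemma unglue_quo W : unglue (quoV B W) = inl W.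
Proof. by rewrite -[quoV B W]/(glue (inl W)) glueK. Qed.

Lemma unglue_sub i (v : vertex (Gs i)) : unglue (subV B v) = inr (existT _ i v).
Proof. by rewrite -[subV B v]/(glue (inr (existT _ i v))) glueK. Qed.

Lemma spoke_quo W : spoke (quoV B W) = 1.
Proof. by rewrite /spoke unglue_quo. Qed.

Lemma spoke_sub i (v : vertex (Gs i)) : spoke (subV B v) = incl B (c v).
Proof. by rewrite /spoke unglue_sub. Qed.

Lemma collapse_quo W : collapse (quoV B W) = val W.
Proof. by rewrite /collapse unglue_quo. Qed.

Lemma collapse_sub i (v : vertex (Gs i)) : collapse (subV B v) = V i.
Proof. by rewrite /collapse unglue_sub. Qed.

Lemma spoke_basepoint W : spoke (basepoint B W) = 1.
Proof.
rewrite /basepoint; case: (blown_up V W) => [[i h]|h].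
  by rewrite spoke_sub c_base hom1.
exact: spoke_quo.
Qed.

Lemma collapse_basepoint W : collapse (basepoint B W) = W.
Proof.
rewrite /basepoint; case: (blown_up V W) => [[i h]|h].
  by rewrite collapse_sub.
exact: collapse_quo.
Qed.

Lemma collapse_tau_quo E : collapse (tau (quoE B E)) = tau E.
Proof.
case: (blown_up V (tau E)) => [[i h]|h].
  by rewrite -(att_tau B h) collapse_sub.
by rewrite -(quo_tau B h) collapse_quo.
Qed.

Lemma Theta_gamma_pull E :
  Theta B (gamma_pull E) = gamma B E * (spoke (tau (quoE B E)))^-1.
Proof.
rewrite /gamma_pull /gamma; case: (blown_up V (tau E)) => [[i h]|h].
  rewrite Theta_path_pull; last exact: att_connected.
  by rewrite -(att_tau B h) spoke_sub c_base hom1 mul1g.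
by rewrite -(quo_tau B h) spoke_quo invg1 mulg1 hom1.
Qed.

Lemma vertex_cases (Q : forall x, Gv G x -> Prop) :
    (forall W g, Q _ (quo_v B W g)) ->
    (forall i (v : vertex (Gs i)) g, Q _ (sub_v B v g)) ->
  forall x (g : Gv G x), Q x g.
Proof.
move=> hq hs x; rewrite -(unglueK x); case: (unglue x) => [W|[i v]] /= g.
  by rewrite -(iso_invK (quo_v B W) g).
by rewrite -(iso_invK (sub_v B v) g).
Qed.

Lemma Theta_Psi_vel x (g : Gv G x) :
  Theta B (Psi (vel g)) = spoke x * vel g * (spoke x)^-1.
Proof.
elim/vertex_cases: x / g => [W g|i v g]; rewrite Psi_vel.
  rewrite Psi_V_quo spoke_quo invg1 mulg1 mul1g Theta_vel /Theta_V.
  case: W g => W hW g /=; case: (blown_up V W) => [[i h]|h].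
    by case/negP: (hW); rewrite h codom_f.
  by rewrite (bool_irrelevance h hW).
rewrite Psi_V_sub Theta_path_pull; last exact: connected_vel.
by rewrite spoke_sub incl_vel.
Qed.

Lemma Theta_Psi_tel e :
  Theta B (Psi (tel e)) = spoke (iota e) * tel e * (spoke (tau e))^-1.
Proof.
rewrite Psi_tel; elim/edge_cases: e => [E|i e]; rewrite /iota -edge_map_ebar.
  have ThetaV : {morph Theta B : y / y^-1} by exact: homV.
  rewrite Psi_E_quo /Psi_quo !ThetaM ThetaV !Theta_gamma_pull Theta_tel.
  rewrite /Theta_E.
  by rewrite !invgM !invgK !mulgA !mulgVK.
rewrite Psi_E_sub /Psi_sub -!sub_tau !spoke_sub Theta_path_pull ?incl_tel //.
exact: connected_tel.
Qed.

Lemma Theta_Psi x y (z : Pi G) :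
  connected_elt x y z -> Theta B (Psi z) = spoke x * z * (spoke y)^-1.
Proof.
move: y z; apply: connected_elt_ind => [r|z e r _ IH].
  exact: Theta_Psi_vel.
by rewrite !PsiM !ThetaM IH Theta_Psi_tel Theta_Psi_vel !mulgA !mulgVK.
Qed.

Lemma Psi_V_connected x (g : Gv G x) :
  connected_elt (collapse x) (collapse x) (Psi (vel g)).
Proof.
elim/vertex_cases: x / g => [W g|i v g]; rewrite Psi_vel.
  by rewrite Psi_V_quo collapse_quo; apply: connected_vel.
by rewrite Psi_V_sub collapse_sub; apply: path_pull_connected.
Qed.

Lemma gamma_pull_connected E : connected_elt (tau E) (tau E) (gamma_pull E).
Proof.
rewrite /gamma_pull; case: (blown_up V (tau E)) => [[i h]|h].
  by rewrite h; apply: path_pull_connected.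
exact: connected1.
Qed.

Lemma Psi_E_connected e :
  connected_elt (collapse (iota e)) (collapse (tau e)) (Psi (tel e)).
Proof.
rewrite Psi_tel; elim/edge_cases: e => [E|i e]; rewrite /iota -edge_map_ebar.
  rewrite !collapse_tau_quo Psi_E_quo.
  apply: connectedM (gamma_pull_connected E).
  apply: connectedM (connected_tel E).
  exact: connectedV (gamma_pull_connected (ebar E)).
by rewrite -!sub_tau !collapse_sub Psi_E_sub; apply: path_pull_connected.
Qed.

Lemma Psi_connected x y (z : Pi G) :
  connected_elt x y z -> connected_elt (collapse x) (collapse y) (Psi z).
Proof.
move: y z; apply: connected_elt_ind => [r|z e r _ IH].
  exact: Psi_V_connected.
rewrite !PsiM; apply: connectedM (Psi_V_connected r).
exact: connectedM IH (Psi_E_connected e).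
Qed.

Lemma Theta_pi1_bijective W : bijective (@Theta_pi1 _ _ _ _ _ _ _ _ _ _ B W).
Proof.
have hP (y : pi1 (basepoint B W)) : connected_elt W W (Psi (val y)).
  by have := Psi_connected (pi1P y); rewrite collapse_basepoint.
exists (fun y => mk_pi1 (hP y)) => x; apply: val_inj => /=.
  exact: Psi_Theta.
by rewrite (Theta_Psi (pi1P x)) spoke_basepoint mul1g invg1 mulg1.
Qed.
End Inverse.

Section Agree.
Variables (Gb : gog) (Hb : gog_aut Gb).
Variables (m : nat) (V : 'I_m -> vertex Gb).
Hypothesis V_inj : injective V.
Variables (Gs : 'I_m -> gog) (Hs : forall i, gog_aut (Gs i)).
Variables (p : forall i, vertex (Gs i)).
Variables (theta : forall i, grp_iso (Gv Gb (V i)) (pi1 (p i))).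
Hypothesis theta_comm : forall i (x : Gv Gb (V i)),
  theta i (Hv Hb (V i) x) = Hpi1 (Hs i) (theta i x).

(** Theta commutes with the automorphisms exactly, so 1 serves as conjugating
    element. *)
Lemma blowup_outer_agree (G : gog) (H : gog_aut G) (B : blowup Hb Hs theta H) :
  outer_agree B.
Proof.
move=> W; split; last first.
  exists 1 => x; apply: val_inj; rewrite /ad mul1g invg1 mulg1.
  exact: Theta_Hstar.
have [unglue glueK unglueK] := vertex_bij B.
have [gunglue gglueK gunglueK] := gedge_bij B.
pose cP i := projT2 (cid (based_paths (p i))).
exact: (Theta_pi1_bijective V_inj glueK unglueK gglueK gunglueK
  (fun i => (cP i).1) (fun i => (cP i).2)).
Qed.
End Agree.

(** * Construction of the blow-up *)

Section Construction.
Variables (Gb : gog) (Hb : gog_aut Gb).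
Variables (m : nat) (V : 'I_m -> vertex Gb).
Hypothesis V_inj : injective V.
Variables (Gs : 'I_m -> gog) (Hs : forall i, gog_aut (Gs i)).
Variables (p : forall i, vertex (Gs i)).
Variables (theta : forall i, grp_iso (Gv Gb (V i)) (pi1 (p i))).
Hypothesis theta_comm : forall i (x : Gv Gb (V i)),
  theta i (Hv Hb (V i) x) = Hpi1 (Hs i) (theta i x).

(** What it takes to attach an end of E at V_i to G_i.  It differs from the data
    in [compatible] in that f_e is a homomorphism. *)
Record anchor i (E : edge Gb) (hE : tau E = V i) := Anchor {
  anchor_v : vertex (Gs i);
  anchor_gamma : Pi (Gs i);
  anchor_connected : connected_elt (p i) anchor_v anchor_gamma;
  anchor_fe : {multiplicative Ge Gb E.1 -> Gv (Gs i) anchor_v};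
  anchor_feE : forall g,
    val (theta i (castv hE (fe E g))) = ad anchor_gamma (vel (anchor_fe g));
  anchor_delta : Gv (Gs i) anchor_v;
  anchor_deltaE :
    val (theta i (castv hE (delta Hb E)))
    = Hstar (Hs i) anchor_gamma * vel anchor_delta * anchor_gamma^-1 }.

(** Since the vertex group embeds in Pi(G_i), the elements x provided by
    compatibility for the various g are unique, hence depend on g
    homomorphically. *)
Lemma compatible_anchor i (E : edge Gb) (hE : tau E = V i) :
  compatible Hb Hs theta i -> inhabited (anchor hE).
Proof.
move=> /(_ E hE)[v [gm [hc /choice[f fE] [y hy]]]].
have fM : {morph f : g h / g * h}.
  move=> g h; apply: vel_inj; apply: (mulgI gm); apply: (mulIg gm^-1).
  rewrite -fE velM.
  have -> : val (theta i (castv hE (fe E (g * h))))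
      = val (theta i (castv hE (fe E g))) * val (theta i (castv hE (fe E h))).
    by rewrite gmulfM castvM gmulfM.
  by rewrite !fE !mulgA mulgVK.
pose f' : {multiplicative Ge Gb E.1 -> Gv (Gs i) v} :=
  HB.pack_for {multiplicative Ge Gb E.1 -> Gv (Gs i) v} f
    (isMultiplicative.Build _ _ f fM).
unshelve refine (inhabits (@Anchor i E hE v gm hc f' fE y _)).
by rewrite -hy homV !mulgA mulgV mul1g mulgK.
Qed.

Variable att : forall i (E : edge Gb) (hE : tau E = V i), anchor hE.

Lemma anchor_fe_inj i E (hE : tau E = V i) : injective (anchor_fe (att hE)).
Proof.
move=> g h e; apply: (@fe_inj _ E).
apply: (castv_inj (h := hE)); apply: (bij_inj (iso_bij (theta i))).
apply: val_inj.
by rewrite !(anchor_feE (att hE)) e.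
Qed.

(** By [vel_inj] it suffices to compute in Pi(G_i), where both sides come from
    theta_i applied to the same relation for E. *)
Lemma anchor_comm i (E : edge Gb) (hE : tau E = V i) (g : Ge Gb E.1) :
  let a := att hE in
  Hv (Hs i) (anchor_v a) (anchor_fe a g)
  = ad (anchor_delta a) (anchor_fe a (He Hb E.1 g)).
Proof.
move=> a; apply: vel_inj; rewrite -Hstar_vel.
set gm := anchor_gamma a.
have vE h : vel (anchor_fe a h)
    = gm^-1 * val (theta i (castv hE (fe E h))) * gm.
  by rewrite (anchor_feE a) /ad !mulgA mulVg mul1g mulgVK.
have dE : vel (anchor_delta a)
        = (Hstar (Hs i) gm)^-1 * val (theta i (castv hE (delta Hb E))) * gm.
  by rewrite (anchor_deltaE a) !mulgA mulVg mul1g mulgVK.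
have HV : {morph Hstar (Hs i) : x / x^-1} by exact: homV.
rewrite /ad !velM velV !vE dE !HstarM HV.
rewrite (_ : Hstar (Hs i) (val _)
    = val (theta i (castv hE (Hv Hb (tau E) (fe E g))))); last first.
  by rewrite castv_Hv theta_comm.
have FM x y : val (theta i (castv hE (x * y)))
    = val (theta i (castv hE x)) * val (theta i (castv hE y)).
  by rewrite castvM gmulfM.
have FV x : val (theta i (castv hE x^-1)) = (val (theta i (castv hE x)))^-1.
  by rewrite castvV homV.
rewrite aut_comm /ad !FM FV.
by rewrite !invgM !invgK !mulgA !(mulgVK, mulgK).
Qed.

Definition blow_vertex : finType := (other_vertex V + {i & vertex (Gs i)})%type.
Definition blow_gedge : finType := (gedge Gb + {i & gedge (Gs i)})%type.

Local Notation site E := ({i | tau E = V i} + {tau E \notin codom V}).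

(** All that concerns the attached ends is defined by cases on an arbitrary
    s : site E, and only then specialised to s = blown_up V (tau E): the type of
    the homomorphism [attach_fe] depends on s. *)
Definition attach_at (E : edge Gb)
    (s : site E) : blow_vertex :=
  match s with
  | inleft (exist i h) => inr (existT _ i (anchor_v (att h)))
  | inright h => inl (exist _ (tau E) h)
  end.

Definition blow_term (e : blow_gedge * bool) : blow_vertex :=
  match e with
  | (inl u, b) => attach_at (blown_up V (tau ((u, b) : edge Gb)))
  | (inr (existT i u), b) => inr (existT _ i (tau ((u, b) : edge (Gs i))))
  end.

Definition blow_rel : rel blow_vertex := fun x y =>
  [exists e : blow_gedge * bool,
     (blow_term (e.1, ~~ e.2) == x) && (blow_term e == y)].

Lemma blow_connect_sub i (v w : vertex (Gs i)) :
  connect blow_rel (inr (existT _ i v)) (inr (existT _ i w)).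
Proof.
have := graph_connected v w.
apply: (connect_homo (h := fun v => inr (existT _ i v) : blow_vertex)).
move=> x y /existsP[[u b] /andP[/eqP <- /eqP <-]]; apply: connect1.
by apply/existsP; exists (inr (existT _ i u), b); rewrite /= !eqxx.
Qed.

Definition blow_base (W : vertex Gb) : blow_vertex :=
  match blown_up V W with
  | inleft (exist i _) => inr (existT _ i (p i))
  | inright h => inl (exist _ W h)
  end.

Lemma blow_connect_attach (E : edge Gb) :
  connect blow_rel (attach_at (blown_up V (tau E))) (blow_base (tau E)) /\
  connect blow_rel (blow_base (tau E)) (attach_at (blown_up V (tau E))).
Proof.
rewrite /blow_base; case: (blown_up V (tau E)) => [[i h]|h] /=.
  by split; apply: blow_connect_sub.
by split; apply: connect0.
Qed.

Lemma blow_connect_base (x : blow_vertex) :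
  exists W,
    connect blow_rel x (blow_base W) /\ connect blow_rel (blow_base W) x.
Proof.
case: x => [[W hW]|[i v]].
  exists W; rewrite /blow_base; case: (blown_up V W) => [[i h]|h].
    by case/negP: (hW); rewrite h codom_f.
  by rewrite (bool_irrelevance h hW); split; apply: connect0.
exists (V i); rewrite /blow_base; case: (blown_up V (V i)) => [[j h]|h].
  by move/V_inj: h => <-; split; apply: blow_connect_sub.
by case/negP: (h); apply: codom_f.
Qed.

(** The graphs of the G_i are connected, and collapsing them gives a connected
    graph. *)
Lemma blow_connected (x y : blow_vertex) : connect blow_rel x y.
Proof.
have [W [xW _]] := blow_connect_base x; have [W' [_ yW]] := blow_connect_base y.
apply: connect_trans xW _; apply: connect_trans _ yW.
have := graph_connected W W'; apply: (connect_homo (h := blow_base)).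
move=> w w' /existsP[E /andP[/eqP <- /eqP <-]].
apply: connect_trans (blow_connect_attach (ebar E)).2 _.
apply: connect_trans _ (blow_connect_attach E).1; apply: connect1.
case: E => u b; apply/existsP; exists (inl u, b); by rewrite /= !eqxx.
Qed.

Lemma blow_nonempty : 0 < #|blow_vertex|.
Proof.
have /card_gt0P[W _] := graph_nonempty Gb.
by apply/card_gt0P; exists (blow_base W).
Qed.

Definition blow_graph : graph := Graph blow_nonempty blow_connected.

Definition blow_Gv (x : blow_vertex) : groupType :=
  match x with
  | inl W => Gv Gb (val W)
  | inr (existT i v) => Gv (Gs i) v
  end.

Definition blow_Ge (u : blow_gedge) : groupType :=
  match u with
  | inl u => Ge Gb u
  | inr (existT i u) => Ge (Gs i) u
  end.

Definition attach_fe (E : edge Gb) (s : site E) :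
    {multiplicative Ge Gb E.1 -> blow_Gv (attach_at s)} :=
  match s with
  | inleft (exist i h) => anchor_fe (att h)
  | inright h => fe E
  end.

Definition attach_delta (E : edge Gb)
    (s : site E) : blow_Gv (attach_at s) :=
  match s with
  | inleft (exist i h) => anchor_delta (att h)
  | inright h => delta Hb E
  end.

Definition blow_fe (e : edge blow_graph) :
    {multiplicative blow_Ge e.1 -> blow_Gv (tau e)} :=
  match e with
  | (inl u, b) => attach_fe (blown_up V (tau ((u, b) : edge Gb)))
  | (inr (existT i u), b) => fe ((u, b) : edge (Gs i))
  end.

Definition blow_delta (e : edge blow_graph) : blow_Gv (tau e) :=
  match e with
  | (inl u, b) => attach_delta (blown_up V (tau ((u, b) : edge Gb)))
  | (inr (existT i u), b) => delta (Hs i) ((u, b) : edge (Gs i))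
  end.

Lemma attach_fe_inj (E : edge Gb) (s : site E) :
  injective (attach_fe s).
Proof.
by case: s => [[i h]|h]; [apply: anchor_fe_inj|apply: (@fe_inj Gb E)].
Qed.

Lemma blow_fe_inj e : injective (blow_fe e).
Proof.
case: e => [[u|[i u]] b]; first exact: attach_fe_inj.
exact: (@fe_inj (Gs i)).
Qed.

Definition blow_gog : gog :=
  @Gog blow_graph blow_Gv blow_Ge blow_fe blow_fe_inj.

Definition blow_Hv (x : blow_vertex) : grp_iso (blow_Gv x) (blow_Gv x) :=
  match x with
  | inl W => Hv Hb (val W)
  | inr (existT i v) => Hv (Hs i) v
  end.

Definition blow_He (u : blow_gedge) : grp_iso (blow_Ge u) (blow_Ge u) :=
  match u with
  | inl u => He Hb u
  | inr (existT i u) => He (Hs i) u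
  end.

Lemma attach_comm (E : edge Gb) (s : site E) g :
  blow_Hv (attach_at s) (attach_fe s g)
  = ad (attach_delta s) (attach_fe s (He Hb E.1 g)).
Proof. by case: s => [[i h]|h]; [apply: anchor_comm|apply: (aut_comm Hb)]. Qed.

Lemma blow_comm (e : edge blow_gog) (g : Ge blow_gog e.1) :
  blow_Hv (tau e) (fe e g) = ad (blow_delta e) (fe e (blow_He e.1 g)).
Proof.
case: e g => [[u|[i u]] b] g; first exact: attach_comm.
exact: (aut_comm (Hs i) ((u, b) : edge (Gs i))).
Qed.

Definition blow_aut : gog_aut blow_gog := GogAut blow_comm.

Lemma id_bij (K : groupType) : bijective (@idfun K).
Proof. by exists idfun. Qed.

Definition iso_id (K : groupType) : grp_iso K K :=
  @GrpIso K K idfun (id_bij K).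

Definition blow_subE i : edge_map (Gs i) blow_gog :=
  @EdgeMap (Gs i) blow_gog (fun u => inr (existT _ i u)) (fun=> false).

Definition blow_quoE : edge_map Gb blow_gog :=
  @EdgeMap Gb blow_gog inl (fun=> false).

(** Since V is injective, tau E determines the index i, so that E has a single
    site. *)
Lemma blown_up_in i (E : edge Gb) (hE : tau E = V i) s : 
  s = inleft (exist _ i hE) :> site E.
Proof.
case: s => [[j h]|h]; last by case/negP: (h); rewrite hE codom_f.
have ij : i = j by apply: V_inj; rewrite -hE.
by subst j; rewrite (eq_irrelevance h hE).
Qed.

Lemma blown_up_out (E : edge Gb) (hE : tau E \notin codom V) s : 
  s = inright hE :> site E.
Proof.
case: s => [[j h]|h]; first by case/negP: (hE); rewrite h codom_f.
by rewrite (bool_irrelevance h hE).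
Qed.

Definition blow_quoV (W : other_vertex V) : vertex blow_gog := inl W.
Definition blow_subV i (v : vertex (Gs i)) : vertex blow_gog :=
  inr (existT _ i v).

Lemma blow_quo_tau_out (E : edge Gb) (hE : tau E \notin codom V) :
  blow_quoV (exist _ (tau E) hE) = tau (blow_quoE E).
Proof.
case: E hE => u b hE.
by rewrite [RHS]/(attach_at _) (blown_up_out hE (blown_up V _)).
Qed.

Lemma blow_quo_tau_in i (E : edge Gb) (hE : tau E = V i) :
  blow_subV (anchor_v (att hE)) = tau (blow_quoE E).
Proof.
case: E hE => u b hE.
by rewrite [RHS]/(attach_at _) (blown_up_in hE (blown_up V _)).
Qed.

Lemma attach_fe_in i (E : edge Gb) (hE : tau E = V i) (s : site E)
    (h : inr (existT _ i (anchor_v (att hE))) = attach_at s) g :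
  attach_fe s g = castv (G := blow_gog) h (anchor_fe (att hE) g).
Proof.
have hs := blown_up_in hE s; subst s; exact: (esym (@castv_id blow_gog _ h _)).
Qed.

Lemma attach_fe_out (E : edge Gb) (hE : tau E \notin codom V) (s : site E)
    (h : inl (exist _ (tau E) hE) = attach_at s) g :
  attach_fe s g = castv (G := blow_gog) h (fe E g).
Proof.
have hs := blown_up_out hE s; subst s; exact: (esym (@castv_id blow_gog _ h _)).
Qed.

Lemma attach_delta_in i (E : edge Gb) (hE : tau E = V i) (s : site E)
    (h : inr (existT _ i (anchor_v (att hE))) = attach_at s) :
  attach_delta s = castv (G := blow_gog) h (anchor_delta (att hE)).
Proof.
have hs := blown_up_in hE s; subst s; exact: (esym (@castv_id blow_gog _ h _)).
Qed.

Lemma attach_delta_out (E : edge Gb) (hE : tau E \notin codom V) (s : site E)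
    (h : inl (exist _ (tau E) hE) = attach_at s) :
  attach_delta s = castv (G := blow_gog) h (delta Hb E).
Proof.
have hs := blown_up_out hE s; subst s; exact: (esym (@castv_id blow_gog _ h _)).
Qed.

Lemma blow_sub_tau i (e : edge (Gs i)) :
  blow_subV (tau e) = tau (blow_subE i e).
Proof. by case: e. Qed.

Lemma blow_exists : inhabited (blowup Hb Hs theta blow_aut).
Proof.
unshelve refine (inhabits (@Blowup Gb Hb m V Gs Hs p theta blow_gog blow_aut
  blow_subV blow_subE blow_quoV blow_quoE _ _ blow_sub_tau
  (fun i v => iso_id (Gv (Gs i) v)) (fun i u => iso_id (Ge (Gs i) u)) _
  _ _ _
  (fun W => iso_id (Gv Gb (val W))) (fun u => iso_id (Ge Gb u)) _ _
  blow_quo_tau_out _ _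
  (fun i E hE => anchor_v (att hE)) blow_quo_tau_in
  (fun i E hE => anchor_gamma (att hE))
  (fun i E hE => anchor_connected (att hE)) _ _)) => //.
- by exists id => -[W|[i v]].
- by exists id => -[W|[i v]].
- move=> i [u b] g; exact: (esym (@castv_id blow_gog _ _ _)).
- move=> i [u b]; exact: (esym (@castv_id blow_gog _ _ _)).
- move=> [u b] hE g; exact: attach_fe_out.
- move=> [u b] hE; exact: attach_delta_out.
- move=> i [u b] hE g; exists (anchor_fe (att hE) g); last exact: anchor_feE.
  exact: attach_fe_in.
- move=> i [u b] hE; exists (anchor_delta (att hE)); last exact: anchor_deltaE.
  exact: attach_delta_in.
Qed.
End Construction.

Theorem theorem1p1
    (Gb : gog) (Hb : gog_aut Gb)
    (m : nat) (V : 'I_m -> vertex Gb) (V_inj : injective V)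
    (Gs : 'I_m -> gog) (Hs : forall i, gog_aut (Gs i))
    (p : forall i, vertex (Gs i))
    (theta : forall i, grp_iso (Gv Gb (V i)) (pi1 (p i)))
    (theta_comm : forall i (x : Gv Gb (V i)),
       theta i (Hv Hb (V i) x) = Hpi1 (Hs i) (theta i x)) :
  (exists (G : gog) (H : gog_aut G) (B : blowup Hb Hs theta H), outer_agree B)
  <-> (forall i : 'I_m, compatible Hb Hs theta i).
Proof.
split=> [[G [H [B _]]] i|comp]; first exact: compatible_blowup B i.
pose att i E hE :=
  inhabited_witness (compatible_anchor (i := i) (E := E) hE (comp i)).
have [B] := blow_exists V_inj theta_comm att.
exists _, _, B; exact: blowup_outer_agree.
Qed.
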